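(* Let $G$ be a countable group, and let $(X,c)$ be a nonempty countable cyclically ordered $G$-set with subexponential growth of orbits. Suppose that $F\colon\mathbb{N}\to[1,+\infty)$ is a non-decreasing function such that $\lim_{n\to\infty}F(n+1)/F(n)=1$, and that for every finite subset $S\subset G$ and every $x\in X$ we have \[\sum_n\frac{|S^nx|}{F(n)}<+\infty.\] Assume further that $\sigma$ is a modulus of continuity such that $t\mapsto\sigma(t)/t$ is decreasing, and that \[\limsup_{n\to\infty}\left|\frac{F(n+1)}{F(n)}-1\right|\cdot\frac{1}{\sigma(F(n)^{-1})}<+\infty.\] Then there exist an action $\rho\colon G\to\mathrm{Diff}^{1,\sigma}_+(\mathbb{S}^1)$ and a family of open intervals $(J_x)_{x\in X}$ in $\mathbb{S}^1$ such that: (i) if $x\neq y$, then $J_x\cap J_y=\varnothing$, and $\bigcup_{x\in X}J_x$ is dense in $\mathbb{S}^1$; (ii) the map $X\to\mathbb{S}^1$ that associates to $x$ the left (equivalently, the right) endpoint of $J_x$ is cyclic-order-preserving; (iii) $\rho(g)(J_x)=J_{gx}$ for every $g\in G$ and $x\in X$, and if $gx=x$ then $\rho(g)$ is the identity on $J_x$.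
   Context: A $G$-set is a set with an action of $G$. For $S\subset G$ and $x\in X$, $S^nx=\{s_1\cdots s_nx : s_j\in S\}$. A $G$-set $X$ has subexponential growth of orbits if for every nonempty finite subset $S\subset G$ and every $x\in X$, $\lim_{n\to\infty}|S^nx|^{1/n}=1$ (no uniformity in $S$ or $x$ is required). A circular (or cyclic) order on a set $X$ is a function $c\colon X\times X\times X\to\{0,1,-1\}$ such that for all $x_1,x_2,x_3,x_4\in X$: (1) $c(x_1,x_2,x_3)=0$ if and only if $x_i=x_j$ for some $i\neq j$; (2) $c(x_2,x_3,x_4)-c(x_1,x_3,x_4)+c(x_1,x_2,x_4)-c(x_1,x_2,x_3)=0$. A map $f\colon(X,c_X)\to(Y,c_Y)$ is cyclic-order-preserving if $c_Y(f(x_1),f(x_2),f(x_3))=c_X(x_1,x_2,x_3)$ for all $x_1,x_2,x_3\in X$. A cyclically ordered $G$-set is a cyclically ordered set $(X,c)$ on which $G$ acts by cyclic-order-preserving transformations. The circle $\mathbb{S}^1=\mathbb{R}/\mathbb{Z}$ carries its standard orientation and circular order, where $c(x,y,z)=1$ if $x,y,z$ are distinct and positively ordered, $-1$ if they are distinct and negatively ordered. Open intervals in $\mathbb{S}^1$ are nonempty, and are images of intervals $(a,b)\subset\mathbb{R}$ with $0<b-a\le 1$; the left and right endpoints are the images of $a$ and $b$. A modulus of continuity is a homeomorphism $\sigma\colon[0,\infty)\to[0,\infty)$. A function $f$ between metric spaces is in the class $C^\sigma$ if $\sup_{x\neq y}d(f(x),f(y))/\sigma(d(x,y))<\infty$.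 $\mathrm{Diff}^{1,\sigma}_+(\mathbb{S}^1)$ is the set of orientation-preserving $C^1$ diffeomorphisms of $\mathbb{S}^1$ whose derivatives are in the class $C^\sigma$; it is a group when $t\mapsto\sigma(t)/t$ is decreasing. An action $\rho$ is a group homomorphism. *)

(* Defs.v *)
From HB Require Import structures.
From mathcomp Require Import all_boot all_order all_fingroup all_algebra.
From mathcomp Require Import finmap.
From mathcomp Require Import all_classical all_reals all_analysis.

Set Implicit Arguments.
Unset Strict Implicit.
Unset Printing Implicit Defensive.

Import Order.TTheory GRing.Theory Num.Theory.
Import numFieldNormedType.Exports.

Local Open Scope classical_set_scope.
Local Open Scope ring_scope.

Definition is_left_action (G : groupType) (T : Type) (act : G -> T -> T) : Prop :=
  (forall x, act 1%g x = x) /\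
  (forall g h x, act (g * h)%g x = act g (act h x)).

Definition power_orbit (G : groupType) (X : Type) (act : G -> X -> X)
    (S : set G) (n : nat) (x : X) : set X :=
  [set act (\prod_(i < n) s i)%g x | s in [set s : 'I_n -> G | forall i, S (s i)]].

(* [fset_set] returns the empty set on infinite sets; it is used here for
   finite S only, so that every S^n x is finite. *)
Definition card_power_orbit (G : groupType) (X : choiceType) (act : G -> X -> X)
    (S : set G) (n : nat) (x : X) : nat :=
  #|` fset_set (power_orbit act S n x)|%fset.

Definition subexponential_orbits (R : realType) (G : groupType) (X : choiceType)
    (act : G -> X -> X) : Prop :=
  forall (S : set G) (x : X), finite_set S -> S !=set0 ->
    (fun n => (card_power_orbit act S n x)%:R `^ (n%:R^-1) : R) @ \oo --> (1 : R).

Definition circular_order (X : Type) (c : X -> X -> X -> int) : Prop :=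
  [/\ forall x y z, c x y z \in [:: 0; 1; -1],
      forall x y z, c x y z = 0 <-> [\/ x = y, x = z | y = z]
    & forall x1 x2 x3 x4,
        c x2 x3 x4 - c x1 x3 x4 + c x1 x2 x4 - c x1 x2 x3 = 0].

Definition cyclic_order_preserving (X Y : Type) (cX : X -> X -> X -> int)
    (cY : Y -> Y -> Y -> int) (f : X -> Y) : Prop :=
  forall x y z, cY (f x) (f y) (f z) = cX x y z.

Definition cyclically_ordered_Gset (G : groupType) (X : Type)
    (act : G -> X -> X) (c : X -> X -> X -> int) : Prop :=
  [/\ circular_order c, is_left_action act
    & forall g, cyclic_order_preserving c c (act g)].

(* The additive subgroup Z of R, that is, the predicate [Num.int]. *)
Definition int_subgroup (R : realType) : zmodClosed R :=
  GRing.ZmodClosed.clone R (@Num.int_num_subdef R) _.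

Definition circle (R : realType) : Type :=
  quotient_topology (Quotient.quot (int_subgroup R)).

HB.instance Definition _ (R : realType) := Topological.on (circle R).

Definition to_circle (R : realType) (t : R) : circle R :=
  \pi_(quotient_topology (Quotient.quot (int_subgroup R)))%qT t.

(* The distance that R/Z inherits from R: the least distance between
   representatives. *)
Definition circle_dist (R : realType) (p q : circle R) : R :=
  inf [set d | exists s t : R,
    [/\ to_circle s = p, to_circle t = q & d = `|s - t|]].

Definition positively_ordered (R : realType) (p q r : circle R) : Prop :=
  exists s t u : R,
    [/\ to_circle s = p, to_circle t = q, to_circle u = r,
        s < t < u & u < s + 1].

Definition circle_order (R : realType) (p q r : circle R) : int :=
  if `[< positively_ordered p q r >] then 1
  else if `[< positively_ordered p r q >] then -1 else 0.

Record open_arc (R : realType) : Type := OpenArc {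
  arc_lo : R;
  arc_hi : R;
  arc_length : 0 < arc_hi - arc_lo <= 1
}.

Definition arc_set (R : realType) (J : open_arc R) : set (circle R) :=
  (@to_circle R) @` `]arc_lo J, arc_hi J[.

Definition left_endpoint (R : realType) (J : open_arc R) : circle R :=
  to_circle (arc_lo J).

Definition right_endpoint (R : realType) (J : open_arc R) : circle R :=
  to_circle (arc_hi J).

Definition modulus_of_continuity (R : realType) (sigma : R -> R) : Prop :=
  let D := `[0, +oo[%classic : set R in
  exists tau : R -> R,
    [/\ set_fun D D sigma, set_fun D D tau,
        (forall t, D t -> tau (sigma t) = t) /\
        (forall t, D t -> sigma (tau t) = t),
        {within D, continuous sigma} & {within D, continuous tau}].

Definition class_C (R : realType) (sigma : R -> R) (f : circle R -> R) : Prop :=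
  has_ubound [set r | exists p q : circle R,
    p <> q /\ r = `|f p - f q| / sigma (circle_dist p q)].

(* [df] is the derivative of [f], both read through the covering R -> R/Z:
   [f] lifts to a differentiable map of R whose derivative at [t] is the value
   of [df] at the class of [t]. *)
Definition is_circle_derivative (R : realType)
    (f : circle R -> circle R) (df : circle R -> R) : Prop :=
  exists F : R -> R,
    (forall t : R, f (to_circle t) = to_circle (F t)) /\
    (forall t : R, is_derive t 1 F (df (to_circle t))).

Definition circle_C1 (R : realType) (f : circle R -> circle R) : Prop :=
  exists2 df, is_circle_derivative f df & continuous df.

Definition circle_C1_diffeo (R : realType) (f : circle R -> circle R) : Prop :=
  exists g, [/\ cancel f g, cancel g f, circle_C1 f & circle_C1 g].

(* Orientation is read off the sign of the derivative.  The group law on the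
   set of such maps is composition. *)
Definition Diff1_plus (R : realType) (sigma : R -> R)
    (f : circle R -> circle R) : Prop :=
  circle_C1_diffeo f /\
  exists df, [/\ is_circle_derivative f df, forall p, 0 < df p
               & class_C sigma df].

(* Main.v *)
Require Import Defs.
From mathcomp Require Import all_boot all_order all_algebra.
From mathcomp Require Import finmap.
From mathcomp Require Import all_classical all_reals all_analysis.
From mathcomp Require Import ring lra zify.

Set Implicit Arguments.
Unset Strict Implicit.
Unset Printing Implicit Defensive.

Import Order.TTheory GRing.Theory Num.Theory.
Import numFieldNormedType.Exports.

Local Open Scope classical_set_scope.
Local Open Scope ring_scope.

(** Give every point [x] of [X] a length [l x > 0], with total 1, lay out intervals
    of these lengths side by side on the circle in the circular order of [X], and
    let [g] map the interval of [x] onto the interval of [g x] by a diffeomorphism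
    which depends only on the two lengths and is tangent to the identity at both
    endpoints. If these interval maps satisfy the cocycle relation
    ([ivmap_comp]), the result is an action on the union of the intervals, where
    an element that fixes [x] acts trivially on the interval of [x]. The union is
    dense because the lengths add up to 1, so the relations extend to the whole
    circle by continuity ([int_valued]).

    Smoothness depends on the ratios [l (g x) / l x], which must be within a
    multiple of [sigma (l x)] of 1 for every fixed [g]. The lengths are
    proportional to [1 / F (ht x)], where the height [ht] is the cost of reaching
    [x] in a weighted version of the word metric ([height_exists]). An element
    changes heights by a bounded amount, so the condition on
    [F (n + 1) / F n] gives the bound on the ratios ([ratio_shift]). The weights
    increase so fast that the balls of the weighted metric are controlled by
    finitely many sets [S^n x] at a time, and the summability hypotheses give
    [sum of (l x) < +oo] although [G] may have infinitely many generators and [X]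
    infinitely many orbits.

    The circle map attached to [g] is, on a fundamental domain starting at the
    interval of a base point, the sum over [x] of the interval maps applied to the
    length of the part of the interval of [x] that lies before [t] ([cmap]).
    Summing the second order estimate for the interval maps ([ivmap_gauge]) shows
    that this map [f] has at every [t] a slope [d] with
    [`|f s - f t - d * (s - t)| <= K * sigma `|s - t| * `|s - t|] for all [s]
    near [t] ([cmap_taylor], [lift_taylor]). This inequality contains
    differentiability, and exchanging [s] and [t] in it gives the regularity of
    the derivative ([taylor_swap]). *)

(** * Moduli of continuity and interval diffeomorphisms *)

Section Gauge.
Variable R : realType.

(** The part of the notion of modulus of continuity that the estimates use:
    [sigma] is nondecreasing, vanishes exactly at 0, is small near 0, and
    [sigma t / t] is nonincreasing. *)
Definition gauge (sigma : R -> R) : Prop :=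
  [/\ sigma 0 = 0,
      forall t, 0 < t -> 0 < sigma t,
      forall s t, 0 <= s -> s <= t -> sigma s <= sigma t,
      forall s t, 0 < s -> s <= t -> sigma t / t <= sigma s / s
    & forall e, 0 < e -> exists2 d, 0 < d & sigma d <= e].

(** A self-homeomorphism of [[0, +oo[]] is increasing: being continuous and
    injective it is strictly monotone, and a decreasing map would be bounded. *)
Lemma gauge_modulus (sigma : R -> R) :
  modulus_of_continuity sigma ->
  (forall s t : R, 0 < s -> s <= t -> sigma t / t <= sigma s / s) ->
  gauge sigma.
Proof.
move=> [tau [sD tD [st ts] sc _]] dec.
have DP (t : R) : (`[0, +oo[%classic : set R) t <-> 0 <= t.
  by rewrite /= in_itv /= andbT.
have s_ge0 t : 0 <= t -> 0 <= sigma t by move=> t0; apply/DP/sD/DP.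
have t_ge0 t : 0 <= t -> 0 <= tau t by move=> t0; apply/DP/tD/DP.
have inj : {in `[0, +oo[ &, injective sigma}.
  move=> x y xD yD /(congr1 tau).
  by rewrite !st //; apply/DP; rewrite in_itv /= andbT in xD yD.
have mono s t : 0 <= s -> s <= t -> sigma s <= sigma t.
  move=> s0 st'.
  have [inc|dcr] := itv_continuous_inj_mono sc inj.
    by rewrite (le_mono_in inc) // in_itv /= andbT // (le_trans s0).
  have h : sigma (tau (sigma 0 + 1)) <= sigma 0.
    rewrite (le_nmono_in dcr) ?in_itv /= ?andbT ?t_ge0 ?addr_ge0 ?s_ge0 //.
  rewrite ts in h; last by apply/DP; rewrite addr_ge0 ?s_ge0.
  by lra.
have sig0 : sigma 0 = 0.
  have tau00 := t_ge0 _ (lexx 0).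
  have := mono _ _ (lexx 0) tau00; rewrite ts; last exact/DP.
  by have := s_ge0 _ (lexx 0); lra.
have pos t : 0 < t -> 0 < sigma t.
  move=> t0; rewrite lt_neqAle s_ge0 ?ltW // andbT.
  apply/eqP => h; have := inj 0 t; rewrite !in_itv /= !andbT lexx ltW //.
  by rewrite sig0 => /(_ isT isT h) h2; rewrite h2 ltxx in t0.
split=> // e e0; exists (tau e); last by rewrite ts //; apply/DP/ltW.
rewrite lt_neqAle t_ge0 ?ltW // andbT; apply/eqP => h.
have := ts e; rewrite -h sig0 => /(_ _) h2.
have /h2 h3 : `[0, +oo[%classic e by apply/DP/ltW.
by rewrite h3 ltxx in e0.
Qed.

Variable sigma : R -> R.
Hypothesis sigmaG : gauge sigma.

Lemma gauge0 : sigma 0 = 0.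
Proof. by case: sigmaG. Qed.

Lemma gauge_gt0 t : 0 < t -> 0 < sigma t.
Proof. by case: sigmaG => _ h _ _ _; exact: h. Qed.

Lemma gauge_le s t : 0 <= s -> s <= t -> sigma s <= sigma t.
Proof. by case: sigmaG => _ _ h _ _; exact: h. Qed.

Lemma gauge_ge0 t : 0 <= t -> 0 <= sigma t.
Proof. by move=> t0; rewrite -gauge0; exact: gauge_le. Qed.

Lemma gauge_ratio s t : 0 < s -> s <= t -> sigma t / t <= sigma s / s.
Proof. by case: sigmaG => _ _ _ h _; exact: h. Qed.

Lemma gauge_small e : 0 < e -> exists2 d, 0 < d & sigma d <= e.
Proof. by case: sigmaG => _ _ _ _ h; exact: h. Qed.

(** Subhomogeneity: dilating the argument by a factor at least 1 multiplies the
    gauge by at most that factor. *)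
Lemma gauge_scale k t : 1 <= k -> 0 <= t -> sigma (k * t) <= k * sigma t.
Proof.
move=> k1; rewrite le_eqVlt => /orP[/eqP <-|t0].
  by rewrite mulr0 gauge0 mulr0.
have k0 : 0 < k by apply: lt_le_trans k1.
have := @gauge_ratio t (k * t) t0 (ler_peMl (ltW t0) k1).
rewrite ler_pdivrMr ?mulr_gt0 // => /le_trans; apply.
by rewrite mulrCA mulrVK ?unitfE ?gt_eqF // mulrC.
Qed.

End Gauge.

Section IntervalMap.
Variable R : realFieldType.
Implicit Types a b c v w tau : R.

(** The parabolic Moebius map [mob tau] is tangent to the identity at its fixed
    point 0, and its derivative at [v] is [(mobden tau v)^-2]. *)
Definition mobden tau v := 1 + tau * v.
Definition mob tau v := v / mobden tau v.

(** The parameter for which [mob] maps [[0, a / 2]] onto [[0, b / 2]]. *)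
Definition ivtau a b := 2 / b - 2 / a.

(** The diffeomorphism from [[0, a]] onto [[0, b]]: a parabolic map on the left
    half, and its mirror image on the right half. It is tangent to the identity
    at both endpoints, and the family is closed under composition. *)
Definition ivmap a b v :=
  if v <= a / 2 then mob (ivtau a b) v else b - mob (ivtau a b) (a - v).

(** The derivative of [ivmap a b]; [Num.min v (a - v)] is the distance from [v] to
    the nearest endpoint. *)
Definition ivder a b v := (mobden (ivtau a b) (Num.min v (a - v)))^-2.

Lemma mobden_gt0 a b v : 0 < a -> 0 < b -> 0 <= v -> v <= a / 2 ->
  0 < mobden (ivtau a b) v.
Proof.
move=> a0 b0 v0 va; rewrite /mobden /ivtau.
have -> : 1 + (2 / b - 2 / a) * v = (1 - v / (a / 2)) + 2 * v / b.
  by field; rewrite !gt_eqF.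
have h : v / (a / 2) <= 1 by rewrite ler_pdivrMr ?mul1r // divr_gt0.
case: (ltrgtP 0 v) v0 => // [v1 _|<- _]; last by rewrite mul0r mulr0 mul0r; lra.
have : 0 < 2 * v / b by rewrite divr_gt0 ?mulr_gt0.
lra.
Qed.

(** The denominator lies between 1 and [a / b], hence is at least [M^-1]. *)
Lemma mobdenV_le a b M v : 0 < a -> 0 < b -> 1 <= M -> b <= M * a ->
  0 <= v -> v <= a / 2 -> (mobden (ivtau a b) v)^-1 <= M.
Proof.
move=> a0 b0 M1 bM v0 va.
have D0 := mobden_gt0 a0 b0 v0 va.
have M0 : 0 < M by lra.
rewrite -[leRHS]invrK lef_pV2 ?posrE ?invr_gt0 // /mobden /ivtau.
have iM : M^-1 <= 1 by rewrite invf_le1.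
have -> : 1 + (2 / b - 2 / a) * v = (1 - v / (a / 2)) * 1 + v / (a / 2) * (a / b).
  by field; rewrite !gt_eqF.
have h : v / (a / 2) <= 1 by rewrite ler_pdivrMr ?mul1r // divr_gt0.
have h0 : 0 <= v / (a / 2) by rewrite divr_ge0 // divr_ge0 // ltW.
have ab : M^-1 <= a / b.
  by rewrite ler_pdivlMr // mulrC ler_pdivrMr // mulrC.
have : (v / (a / 2)) * M^-1 <= v / (a / 2) * (a / b) by apply: ler_wpM2l.
have : (1 - v / (a / 2)) * M^-1 <= (1 - v / (a / 2)) * 1.
  by apply: ler_wpM2l => //; lra.
lra.
Qed.

Lemma mob_half a b : 0 < a -> 0 < b -> mob (ivtau a b) (a / 2) = b / 2.
Proof.
move=> a0 b0; rewrite /mob /mobden /ivtau.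
have -> : 1 + (2 / b - 2 / a) * (a / 2) = a / b by field; rewrite !gt_eqF.
by field; rewrite !gt_eqF.
Qed.

Lemma mob_le_half a b v : 0 < a -> 0 < b -> 0 <= v -> v <= a / 2 ->
  0 <= mob (ivtau a b) v <= b / 2.
Proof.
move=> a0 b0 v0 va; have D0 := mobden_gt0 a0 b0 v0 va.
rewrite divr_ge0 ?(ltW D0) //= ler_pdivrMr // /mobden /ivtau.
have -> : b / 2 * (1 + (2 / b - 2 / a) * v) = b / 2 - b / 2 * (v / (a / 2)) + v.
  by field; rewrite !gt_eqF.
have h : v / (a / 2) <= 1 by rewrite ler_pdivrMr ?mul1r // divr_gt0.
have : b / 2 * (v / (a / 2)) <= b / 2 * 1 by apply: ler_wpM2l => //; lra.
lra.
Qed.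

Lemma mob_gt0 a b v : 0 < a -> 0 < b -> 0 < v -> v <= a / 2 ->
  0 < mob (ivtau a b) v.
Proof.
by move=> a0 b0 v0 va; rewrite divr_gt0 // mobden_gt0 // ltW.
Qed.

Lemma mob_comp a b c v : 0 < a -> 0 < b -> 0 < c -> 0 <= v -> v <= a / 2 ->
  mob (ivtau b c) (mob (ivtau a b) v) = mob (ivtau a c) v.
Proof.
move=> a0 b0 c0 v0 va.
have /andP[w0 wb] := mob_le_half a0 b0 v0 va.
have D0 := mobden_gt0 a0 b0 v0 va.
have D1 := mobden_gt0 b0 c0 w0 wb.
have D2 := mobden_gt0 a0 c0 v0 va.
have e : mobden (ivtau b c) (mob (ivtau a b) v)
    = mobden (ivtau a c) v / mobden (ivtau a b) v.
  rewrite {1}/mobden /mob.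
  apply: (@mulIf _ (mobden (ivtau a b) v)); first by rewrite gt_eqF.
  rewrite mulrVK ?unitfE ?gt_eqF // mulrDl mul1r mulrA.
  by rewrite mulrVK ?unitfE ?gt_eqF // /mobden /ivtau; ring.
rewrite {1}/mob e /mob; field.
by rewrite !gt_eqF.
Qed.

Lemma ivtau_id a : ivtau a a = 0. Proof. by rewrite /ivtau subrr. Qed.

Lemma mob0 v : mob 0 v = v.
Proof. by rewrite /mob /mobden mul0r addr0 divr1. Qed.

Lemma mobv0 tau : mob tau 0 = 0. Proof. by rewrite /mob mul0r. Qed.

Lemma ivmap_id a v : ivmap a a v = v.
Proof. by rewrite /ivmap ivtau_id !mob0; case: ifP => // _; ring. Qed.

Lemma ivmap0 a b : 0 < a -> ivmap a b 0 = 0.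
Proof. by move=> a0; rewrite /ivmap mobv0 divr_ge0 // ltW. Qed.

Lemma ivmap_end a b : 0 < a -> ivmap a b a = b.
Proof.
move=> a0; rewrite /ivmap subrr mobv0 subr0 ifF //.
by apply/negbTE; rewrite -ltNge; lra.
Qed.

Lemma ivmap_left a b v : v <= a / 2 -> ivmap a b v = mob (ivtau a b) v.
Proof. by rewrite /ivmap => ->. Qed.

Lemma ivmap_right a b v : 0 < a -> 0 < b -> a / 2 <= v ->
  ivmap a b v = b - mob (ivtau a b) (a - v).
Proof.
move=> a0 b0 va; rewrite /ivmap; case: ifP => // vle.
have -> : v = a / 2 by lra.
have -> : a - a / 2 = a / 2 by lra.
by rewrite mob_half //; lra.
Qed.

Lemma ivmap_itv a b v : 0 < a -> 0 < b -> 0 <= v -> v <= a ->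
  0 <= ivmap a b v <= b.
Proof.
move=> a0 b0 v0 va; case: (leP v (a / 2)) => h.
  rewrite ivmap_left //.
  have /andP[? ?] := mob_le_half a0 b0 v0 h.
  by apply/andP; split; lra.
rewrite ivmap_right // ?(ltW h) //.
have /andP[] := @mob_le_half a b (a - v) a0 b0 ltac:(lra) ltac:(lra).
by move=> ? ?; apply/andP; split; lra.
Qed.

Lemma ivmap_itvoo a b v : 0 < a -> 0 < b -> 0 < v -> v < a ->
  0 < ivmap a b v < b.
Proof.
move=> a0 b0 v0 va; case: (leP v (a / 2)) => h.
  rewrite ivmap_left //; apply/andP; split; first exact: mob_gt0.
  by have /andP[_ ?] := mob_le_half a0 b0 (ltW v0) h; lra.
rewrite ivmap_right // ?(ltW h) //.
have /andP[_ ?] := @mob_le_half a b (a - v) a0 b0 ltac:(lra) ltac:(lra).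
have := @mob_gt0 a b (a - v) a0 b0 ltac:(lra) ltac:(lra).
by move=> ?; apply/andP; split; lra.
Qed.

(** The cocycle relation, by which the interval maps fit together into an action. *)
Lemma ivmap_comp a b c v : 0 < a -> 0 < b -> 0 < c -> 0 <= v -> v <= a ->
  ivmap b c (ivmap a b v) = ivmap a c v.
Proof.
move=> a0 b0 c0 v0 va; case: (leP v (a / 2)) => h.
  rewrite [ivmap a b v]ivmap_left // [RHS]ivmap_left // ivmap_left ?mob_comp //.
  by have /andP[] := mob_le_half a0 b0 v0 h.
have h' := ltW h.
have /andP[? ?] := @mob_le_half a b (a - v) a0 b0 ltac:(lra) ltac:(lra).
rewrite [ivmap a b v]ivmap_right // [RHS]ivmap_right // ivmap_right //; last by lra.
by rewrite (_ : b - (b - _) = mob (ivtau a b) (a - v)) ?mob_comp //; lra.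
Qed.

Lemma ivder_left a b v : v <= a / 2 -> ivder a b v = (mobden (ivtau a b) v)^-2.
Proof. by move=> h; rewrite /ivder min_l //; lra. Qed.

Lemma ivder_right a b v : a / 2 <= v ->
  ivder a b v = (mobden (ivtau a b) (a - v))^-2.
Proof. by move=> h; rewrite /ivder min_r //; lra. Qed.

Lemma ivder_gt0 a b v : 0 < a -> 0 < b -> 0 <= v -> v <= a -> 0 < ivder a b v.
Proof.
move=> a0 b0 v0 va; case: (leP v (a / 2)) => h.
  by rewrite ivder_left // invr_gt0 exprn_gt0 // mobden_gt0.
rewrite ivder_right ?(ltW h) // invr_gt0 exprn_gt0 // mobden_gt0 //; lra.
Qed.

Section Estimates.
Variables (a b M : R).
Hypotheses (a0 : 0 < a) (b0 : 0 < b) (M1 : 1 <= M) (bM : b <= M * a).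
Let tau := ivtau a b.
Let D := mobden tau.
Let N := `|tau| * M ^+ 3.

Let half v := 0 <= v /\ v <= a / 2.

Let Dgt0 v : half v -> 0 < D v.
Proof. by case=> v0 va; apply: mobden_gt0. Qed.

Let DV_le v : half v -> (D v)^-1 <= M.
Proof. by case=> v0 va; apply: mobdenV_le. Qed.

Let DV3_le u v w : half u -> half v -> half w ->
  (D u)^-1 * (D v)^-1 * (D w)^-1 <= M ^+ 3.
Proof.
move=> hu hv hw; rewrite !exprS expr0 mulr1 mulrA.
by rewrite !ler_pM ?mulr_ge0 ?invr_ge0 ?(ltW (Dgt0 _)) ?DV_le.
Qed.

Let mob_quad v w : half v -> half w ->
  `|mob tau w - mob tau v - (D v)^-2 * (w - v)| <= N * (w - v) ^+ 2.
Proof.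
move=> hv hw; have Dv := Dgt0 hv; have Dw := Dgt0 hw.
have -> : mob tau w - mob tau v - (D v)^-2 * (w - v) =
    (- tau * ((D v)^-1 * (D v)^-1 * (D w)^-1)) * (w - v) ^+ 2.
  move: Dv Dw; rewrite /mob /D /mobden => Dv Dw; field.
  by rewrite !gt_eqF.
rewrite normrM (ger0_norm (sqr_ge0 (w - v))) ler_wpM2r ?sqr_ge0 //.
rewrite normrM normrN ler_wpM2l // ger0_norm ?DV3_le //.
by rewrite !mulr_ge0 ?invr_ge0 ?(ltW Dv) ?(ltW Dw).
Qed.

Let D_lip v w : half v -> half w ->
  `|(D w)^-2 - (D v)^-2| <= 2 * N * `|w - v|.
Proof.
move=> hv hw; have Dv := Dgt0 hv; have Dw := Dgt0 hw.
have -> : (D w)^-2 - (D v)^-2 =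
  - tau * ((D v)^-1 * (D v)^-1 * (D w)^-1 + (D v)^-1 * (D w)^-1 * (D w)^-1)
    * (w - v).
  move: Dv Dw; rewrite /D /mobden => Dv Dw; field.
  by rewrite !gt_eqF.
rewrite normrM ler_wpM2r // normrM normrN /N (mulrC 2) -[leRHS]mulrA ler_wpM2l //.
have h1 := DV3_le hv hv hw; have h2 := DV3_le hv hw hw.
rewrite ger0_norm; first by lra.
by rewrite addr_ge0 // !mulr_ge0 ?invr_ge0 ?(ltW Dv) ?(ltW Dw).
Qed.

(* Expansion across the midpoint, in the coordinates [v] and [w] that measure the
   distance to the nearest endpoint on either side. *)
Let cross v w : half v -> half w ->
  `|mob tau (a / 2) - mob tau w + (mob tau (a / 2) - mob tau v)
     - (D v)^-2 * (a - w - v)| <= N * (a - w - v) ^+ 2.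
Proof.
move=> hv hw.
have hh : half (a / 2) by split=> //; rewrite divr_ge0 // ltW.
set e := a / 2 in hh *.
have ve : 0 <= e - v by case: hv; rewrite -/e; lra.
have we : 0 <= e - w by case: hw; rewrite -/e; lra.
have ae : a = e + e by rewrite /e; lra.
have q1 := mob_quad hv hh; have q2 := mob_quad hh hw.
have q3 := D_lip hv hh; rewrite (ger0_norm ve) in q3.
have q4 : `|((D e)^-2 - (D v)^-2) * (e - w)| <= 2 * N * (e - v) * (e - w).
  by rewrite normrM (ger0_norm we) ler_wpM2r.
move: q1 q2 q4; rewrite ae !ler_norml => /andP[p1 p1'] /andP[p2 p2'] /andP[p4 p4'].
by apply/andP; split; lra.
Qed.

(** Second order Taylor estimate, uniform over the interval. *)
Lemma ivmap_quad v w : 0 <= v -> v <= a -> 0 <= w -> w <= a ->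
  `|ivmap a b w - ivmap a b v - ivder a b v * (w - v)| <= N * (w - v) ^+ 2.
Proof.
move=> v0 va w0 wa.
have mh : mob tau (a / 2) = b / 2 by exact: mob_half.
case: (leP v (a / 2)) => hv; case: (leP w (a / 2)) => hw.
- by rewrite !ivmap_left // ivder_left //; apply: mob_quad.
- rewrite ivmap_right ?(ltW hw) // ivmap_left // ivder_left //.
  have := @cross v (a - w) (conj v0 hv) ltac:(split; lra).
  rewrite mh -/tau -/D.
  rewrite (_ : b / 2 - _ + _ = b - mob tau (a - w) - mob tau v); last by lra.
  by rewrite opprB addrCA subrr addr0.
- rewrite ivmap_left // ivmap_right ?(ltW hv) // ivder_right ?(ltW hv) //.
  have := @cross (a - v) w ltac:(split; lra) (conj w0 hw).
  rewrite mh -/tau -/(D (a - v)); set d := (D (a - v))^-2 => h.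
  rewrite -normrN (_ : (w - v) ^+ 2 = (a - w - (a - v)) ^+ 2); last by ring.
  by apply: le_trans h; rewrite le_eqVlt; apply/orP; left; apply/eqP;
    congr `|_|; field.
- rewrite !ivmap_right ?(ltW hv) ?(ltW hw) // ivder_right ?(ltW hv) //.
  have := @mob_quad (a - v) (a - w) ltac:(split; lra) ltac:(split; lra).
  rewrite -/tau -/(D (a - v)); set d := (D (a - v))^-2 => h.
  rewrite -normrN (_ : (w - v) ^+ 2 = (a - w - (a - v)) ^+ 2); last by ring.
  by apply: le_trans h; rewrite le_eqVlt; apply/orP; left; apply/eqP;
    congr `|_|; ring.
Qed.

End Estimates.
End IntervalMap.

Section IntervalGauge.
Variables (R : realType) (sigma : R -> R) (a b M C : R).
Hypotheses (sigmaG : gauge sigma) (a0 : 0 < a) (b0 : 0 < b) (M1 : 1 <= M).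
Hypotheses (bM : b <= M * a) (aM : a <= M * b) (C0 : 0 <= C).
Hypothesis ab_gauge : `|b / a - 1| <= C * sigma a.

Let K := 4 * M ^+ 4 * C.

Let N_gauge r : 0 <= r -> r <= a ->
  2 * (`|ivtau a b| * M ^+ 3) * r <= K * sigma r.
Proof.
move=> r0 ra; have M0 : 0 < M by apply: lt_le_trans M1.
case: (ltrgtP 0 r) r0 => // [r0 _|<- _]; last first.
  by rewrite mulr0 gauge0 // mulr0.
have tauE : ivtau a b = - (2 / b) * (b / a - 1).
  by rewrite /ivtau; field; rewrite !gt_eqF.
have ib : b^-1 <= M / a by rewrite ler_pdivlMr // mulrC ler_pdivrMr.
have h1 : `|ivtau a b| <= 2 * (M / a) * (C * sigma a).
  rewrite tauE normrM normrN (@ger0_norm _ (2 / b)); last by rewrite divr_ge0 // ltW.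
  apply: ler_pM => //; first by rewrite divr_ge0 // ltW.
  by rewrite ler_pM2l.
have h2 := gauge_ratio sigmaG r0 ra.
have h3 : sigma a / a * r <= sigma r by rewrite -ler_pdivlMr.
rewrite /K; apply: (@le_trans _ _ (4 * M ^+ 4 * C * (sigma a / a * r))); last first.
  apply: ler_wpM2l => //; apply: mulr_ge0 => //; apply: mulr_ge0 => //.
  by apply: exprn_ge0; exact: ltW.
rewrite [leRHS](_ : _ = 2 * (2 * (M / a) * (C * sigma a) * M ^+ 3) * r); last first.
  by field; rewrite gt_eqF.
apply: ler_wpM2r; first exact: ltW.
apply: ler_wpM2l => //; apply: ler_wpM2r => //.
by apply: exprn_ge0; exact: ltW.
Qed.

(** When the ratio of the lengths is within [C * sigma a] of 1, the expansion error
    is controlled by the gauge: [sigma a / a] may be replaced by [sigma r / r] for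
    [r <= a]. *)
Lemma ivmap_gauge v w : 0 <= v -> v <= a -> 0 <= w -> w <= a ->
  `|ivmap a b w - ivmap a b v - ivder a b v * (w - v)|
    <= K * sigma `|w - v| * `|w - v|.
Proof.
move=> v0 va w0 wa; apply: le_trans (ivmap_quad a0 b0 M1 bM v0 va w0 wa) _.
rewrite -real_normK ?num_real // expr2 mulrA ler_wpM2r //.
apply: le_trans (N_gauge _ _) => //; last first.
  by rewrite ler_norml; apply/andP; split; lra.
have N0 : 0 <= `|ivtau a b| * M ^+ 3.
  by apply: mulr_ge0 => //; apply: exprn_ge0; apply: le_trans M1.
by apply: ler_wpM2r => //; lra.
Qed.

End IntervalGauge.

(** * Sums of nonnegative families *)

Section NonnegSums.
Variables (R : realType) (X : choiceType).
Implicit Types (u v : X -> R) (k B : R).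

(** Sum of a nonnegative real family indexed by [X]; meaningful for the families
    that satisfy [nsummable]. *)
Definition nsum u : R := fine (\esum_(x in [set: X]) (u x)%:E).

(** Nonnegative families with a finite sum. *)
Definition nsummable u : Prop :=
  (forall x, 0 <= u x) /\ (\esum_(x in [set: X]) (u x)%:E < +oo)%E.

Lemma nsummable_ge0 u x : nsummable u -> 0 <= u x.
Proof. by case. Qed.

Lemma nsumE u : nsummable u -> \esum_(x in [set: X]) (u x)%:E = (nsum u)%:E.
Proof.
move=> [u0 uoo]; rewrite /nsum fineK // fin_numE gt_eqF ?lt_eqF //.
by apply: (@lt_le_trans _ _ 0%E) => //; apply: esum_ge0 => x _; rewrite lee_fin.
Qed.

Lemma esum_fin_le u B : (forall x, 0 <= u x) ->
  (forall s : seq X, uniq s -> \sum_(x <- s) u x <= B) ->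
  (\esum_(x in [set: X]) (u x)%:E <= B%:E)%E.
Proof.
move=> u0 h; rewrite ge_ereal_sup //= => _ [A [finA _]] <-.
by rewrite fsbig_finite //= sumEFin lee_fin; apply: h; exact: fset_uniq.
Qed.

Lemma nsummable_fin u B : (forall x, 0 <= u x) ->
  (forall s : seq X, uniq s -> \sum_(x <- s) u x <= B) -> nsummable u.
Proof.
by move=> u0 h; split=> //; apply: le_lt_trans (esum_fin_le u0 h) (ltry _).
Qed.

Lemma nsum_fin_le u B : (forall x, 0 <= u x) ->
  (forall s : seq X, uniq s -> \sum_(x <- s) u x <= B) -> nsum u <= B.
Proof.
move=> u0 h; rewrite -lee_fin -nsumE; first exact: esum_fin_le.
exact: nsummable_fin h.
Qed.

Lemma nsum_ge_fin u (s : seq X) : nsummable u -> uniq s ->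
  \sum_(x <- s) u x <= nsum u.
Proof.
move=> su us; rewrite -lee_fin -nsumE //; apply: esum_ge.
exists [set` s]; first by split=> //; exact: finite_seq.
by rewrite -fsbig_seq //= sumEFin.
Qed.

Lemma nsum_ge u x : nsummable u -> u x <= nsum u.
Proof.
by move=> su; have := @nsum_ge_fin u [:: x] su isT; rewrite big_seq1.
Qed.

Lemma nsum_ge0 u : nsummable u -> 0 <= nsum u.
Proof. by move=> su; have := @nsum_ge_fin u [::] su isT; rewrite big_nil. Qed.

Lemma nsummable_le u v : (forall x, 0 <= u x) -> (forall x, u x <= v x) ->
  nsummable v -> nsummable u.
Proof.
move=> u0 uv [v0 vo]; split=> //; apply: le_lt_trans vo.
by apply: le_esum => x _; rewrite lee_fin.
Qed.

Lemma nsum_le u v : nsummable u -> nsummable v -> (forall x, u x <= v x) ->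
  nsum u <= nsum v.
Proof.
move=> su sv uv; rewrite -lee_fin -!nsumE //.
by apply: le_esum => x _; rewrite lee_fin.
Qed.

Lemma nsummableD u v : nsummable u -> nsummable v -> nsummable (fun x => u x + v x).
Proof.
move=> su sv; split=> [x|]; first by rewrite addr_ge0 // nsummable_ge0.
under eq_esum do rewrite EFinD.
rewrite esumD; try by move=> x _; rewrite lee_fin; apply: nsummable_ge0.
by rewrite !nsumE // -EFinD ltry.
Qed.

Lemma nsumD u v : nsummable u -> nsummable v ->
  nsum (fun x => u x + v x) = nsum u + nsum v.
Proof.
move=> su sv; apply: EFin_inj; rewrite -nsumE; last exact: nsummableD.
under eq_esum do rewrite EFinD.
rewrite esumD; try by move=> x _; rewrite lee_fin; apply: nsummable_ge0.
by rewrite !nsumE.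
Qed.

Lemma nsummableZ k u : 0 <= k -> nsummable u -> nsummable (fun x => k * u x).
Proof.
move=> k0 su; apply: (@nsummable_fin _ (k * nsum u)) => [x|s us].
  by rewrite mulr_ge0 // nsummable_ge0.
by rewrite -mulr_sumr ler_wpM2l // nsum_ge_fin.
Qed.

Lemma nsumZ_le k u : 0 <= k -> nsummable u -> nsum (fun x => k * u x) <= k * nsum u.
Proof.
move=> k0 su; apply: nsum_fin_le => [x|s us].
  by rewrite mulr_ge0 // nsummable_ge0.
by rewrite -mulr_sumr ler_wpM2l // nsum_ge_fin.
Qed.

Lemma nsumZ k u : 0 <= k -> nsummable u -> nsum (fun x => k * u x) = k * nsum u.
Proof.
move=> k0 su; apply/eqP; rewrite eq_le nsumZ_le //=.
case: (ltrgtP 0 k) k0 => // [k0 _|<- _]; last first.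
  rewrite mul0r; apply: nsum_ge0; apply: nsummableZ => //.
rewrite mulrC -ler_pdivlMr // mulrC.
have := @nsumZ_le k^-1 _ _ (nsummableZ (ltW k0) su).
rewrite invr_ge0 (ltW k0) => /(_ isT); apply: le_trans.
rewrite le_eqVlt; apply/orP; left; apply/eqP; congr nsum; apply/funext => x.
by rewrite mulKf // gt_eqF.
Qed.

Lemma nsummable_bij u (e f : X -> X) : cancel e f -> cancel f e ->
  nsummable u -> nsummable (fun x => u (e x)).
Proof.
move=> ef fe su; split=> [x|]; first exact: nsummable_ge0.
rewrite -(@reindex_esum _ _ _ setT setT e (fun x => (u x)%:E)).
  by rewrite nsumE // ltry.
by split=> [//|x y _ _ /(can_inj ef)//|x _]; exists (f x).
Qed.

Lemma nsum_bij u (e f : X -> X) : cancel e f -> cancel f e ->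
  nsum (fun x => u (e x)) = nsum u.
Proof.
move=> ef fe; congr fine.
rewrite -(@reindex_esum _ _ _ setT setT e (fun x => (u x)%:E)) //.
by split=> [//|x y _ _ /(can_inj ef)//|x _]; exists (f x).
Qed.

Lemma eq_Sm u v : (forall x, u x = v x) -> nsum u = nsum v.
Proof. by move=> /funext ->. Qed.

Lemma sum_delta (s : seq X) x k : uniq s -> 0 <= k ->
  \sum_(y <- s) (if y == x then k else 0) <= k.
Proof.
move=> us k0; rewrite -big_mkcond /= -big_filter.
suff : (size [seq y <- s | y == x] <= 1)%N.
  case: [seq _ <- _ | _] => [|z [|? ?]] //; first by rewrite big_nil.
  by rewrite big_seq1.
rewrite size_filter.
change ((count_mem x s <= 1)%N).
by rewrite count_uniq_mem // leq_b1.
Qed.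

Lemma nsummable_delta x k : 0 <= k -> nsummable (fun y => if y == x then k else 0).
Proof.
move=> k0; apply: (@nsummable_fin _ k) => [y|s us]; first by case: ifP.
exact: sum_delta.
Qed.

Lemma nsum_delta x k : 0 <= k -> nsum (fun y => if y == x then k else 0) = k.
Proof.
move=> k0; apply/eqP; rewrite eq_le; apply/andP; split.
  by apply: nsum_fin_le => [y|s us]; [case: ifP|exact: sum_delta].
by have := @nsum_ge _ x (nsummable_delta x k0); rewrite eqxx.
Qed.

Lemma nsum0 : nsum (fun=> 0) = 0.
Proof. by rewrite /nsum esum1. Qed.

End NonnegSums.

(** * Ratios of values of the growth function *)

(** From an upper limit to a bound valid for all indices. *)
Lemma limn_esup_bounded (R : realType) (u : nat -> R) :
  (limn_esup (fun n => (u n)%:E) < +oo)%E -> exists B, forall n, u n <= B.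
Proof.
rewrite /limn_esup /limf_esup => /ereal_inf_lt[_ [V [N _ NV] <-]] supV.
have [b hb] : exists b, forall n, (N <= n)%N -> u n <= b.
  set s := ereal_sup _ in supV.
  have h n : (N <= n)%N -> ((u n)%:E <= s)%E.
    by move=> Nn; apply: ereal_sup_ubound; exists n => //; apply: NV.
  move: s supV h => [r _ h|//|_ h]; first by exists r => n /h; rewrite lee_fin.
  by exists 0 => n /h; rewrite leeNy_eq.
exists (b + \sum_(i < N) `|u i| + `|b|) => n.
have s0 : 0 <= \sum_(i < N) `|u i| by apply: sumr_ge0.
case: (leqP N n) => [/hb h|nN].
  by have := normr_ge0 b; lra.
have : `|u n| <= \sum_(i < N) `|u i|.
  by rewrite (bigD1 (Ordinal nN)) //= lerDl sumr_ge0.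
have := ler_norm (u n); have := ler_norm (- b); rewrite normrN; lra.
Qed.

Section Ratio.
Variables (R : realType) (F : nat -> R) (sigma : R -> R).
Hypotheses (sigmaG : gauge sigma) (F_ge1 : forall n, 1 <= F n).
Hypothesis (F_nd : nondecreasing_seq F).
Hypothesis F_sigma : (limn_esup (fun n =>
    (`|F n.+1 / F n - 1| * (1 / sigma ((F n)^-1)))%:E) < +oo)%E.

Let F_gt0 n : 0 < F n. Proof. exact: lt_le_trans (F_ge1 n). Qed.

Let sF_gt0 n : 0 < sigma (F n)^-1.
Proof. by apply: gauge_gt0 => //; rewrite invr_gt0. Qed.

Let s1_gt0 : 0 < sigma 1. Proof. exact: gauge_gt0. Qed.

Lemma ratio_step : exists2 C, 0 <= C &
  forall n, F n.+1 / F n - 1 <= C * sigma (F n)^-1.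
Proof.
have [B hB] := limn_esup_bounded F_sigma; exists `|B| => // n.
have := hB n; rewrite div1r ler_pdivrMr // => h.
apply: le_trans (ler_norm _) _; apply: le_trans h _.
by rewrite ler_wpM2r ?(ltW (sF_gt0 n)) // ler_norm.
Qed.

Lemma ratio_steps j : exists2 C, 0 <= C & forall n,
  F (n + j) / F n - 1 <= C * sigma (F n)^-1.
Proof.
have [C C0 hC] := ratio_step.
elim: j => [|j [D D0 hD]].
  by exists 0 => // n; rewrite addn0 divff ?gt_eqF // subrr mul0r.
exists (C * (1 + D * sigma 1) + D).
  by rewrite addr_ge0 // mulr_ge0 // addr_ge0 // mulr_ge0 // ltW.
move=> n; rewrite addnS.
have Fn := F_gt0 n; have Fnj := F_gt0 (n + j)%N.
have -> : F (n + j).+1 / F n - 1 =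
   (F (n + j).+1 / F (n + j)%N - 1) * (F (n + j)%N / F n) + (F (n + j)%N / F n - 1).
  by field; rewrite !gt_eqF.
have s1 : sigma (F n)^-1 <= sigma 1.
  by apply: gauge_le => //; rewrite ?invr_ge0 ?(ltW Fn) ?invf_le1.
have s2 : sigma (F (n + j)%N)^-1 <= sigma (F n)^-1.
  apply: gauge_le => //; rewrite ?invr_ge0 ?(ltW Fnj) //.
  by rewrite lef_pV2 ?posrE //; apply: F_nd; rewrite ?leEnat leq_addr.
have h1 := hD n.
have h2 : D * sigma (F n)^-1 <= D * sigma 1 by apply: ler_wpM2l.
have h3 : F (n + j).+1 / F (n + j)%N - 1 <= C * sigma (F n)^-1.
  by apply: le_trans (hC _) _; apply: ler_wpM2l.
have h4 : 0 <= F (n + j).+1 / F (n + j)%N - 1.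
  by rewrite subr_ge0 ler_pdivlMr // mul1r; apply: F_nd; rewrite ?leEnat.
rewrite [leRHS]mulrDl (mulrAC C); apply: lerD => //; apply: ler_pM => //.
  by rewrite divr_ge0 // ltW.
by lra.
Qed.

(** Indices at bounded distance have values of [F] whose ratio is within a multiple
    of [sigma (F n)^-1] of 1. *)
Lemma ratio_shift j : exists2 C, 0 <= C & forall n p,
  (n <= p + j)%N -> (p <= n + j)%N ->
  `|F n / F p - 1| <= C * sigma (F n)^-1.
Proof.
have [C C0 hC] := ratio_steps j.
pose D := 1 + C * sigma 1.
have D1 : 1 <= D by rewrite lerDl mulr_ge0 // ltW.
exists (C * D); first by rewrite mulr_ge0 //; lra.
move=> n p np pn; have Fn := F_gt0 n; have Fp := F_gt0 p.
have sn := sF_gt0 n.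
have s1 : C * sigma (F p)^-1 <= C * sigma 1.
  apply: ler_wpM2l => //; apply: gauge_le => //;
    by rewrite ?invr_ge0 ?(ltW Fp) ?invf_le1.
case: (leqP n p) => [le_np|lt_pn].
  have Fnp : F n <= F p by apply: F_nd; rewrite ?leEnat.
  have Fpj : F p <= F (n + j)%N by apply: F_nd; rewrite ?leEnat.
  have h1 : 1 <= F p / F n by rewrite ler_pdivlMr // mul1r.
  have h2 : F p / F n <= F (n + j)%N / F n by rewrite ler_pM2r ?invr_gt0.
  have h3 : F n / F p <= 1 by rewrite ler_pdivrMr // mul1r.
  (* both ratios have product 1, so their deviations from 1 compare *)
  have h4 : 1 - F n / F p <= F p / F n - 1.
    have : (F p / F n - 1) * (1 - F n / F p) >= 0 by rewrite mulr_ge0; lra.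
    rewrite (_ : _ * _ = F p / F n - 1 - (1 - F n / F p)); first by lra.
    by field; rewrite !gt_eqF.
  rewrite ler0_norm; last by lra.
  have h5 := hC n; have : C * sigma (F n)^-1 <= C * D * sigma (F n)^-1.
    by rewrite -mulrA (mulrC D) mulrA ler_peMr // mulr_ge0 // ltW.
  lra.
have Fpn : F p <= F n by apply: F_nd; rewrite ?leEnat ltnW.
have Fnj : F n <= F (p + j)%N by apply: F_nd; rewrite ?leEnat.
have h1 : 1 <= F n / F p by rewrite ler_pdivlMr // mul1r.
have h2 : F n / F p <= F (p + j)%N / F p by rewrite ler_pM2r ?invr_gt0.
have h5 := hC p.
rewrite ger0_norm; last by lra.
have nD : F n / F p <= D by rewrite /D; lra.
have h6 : sigma (F p)^-1 <= D * sigma (F n)^-1.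
  apply: le_trans (gauge_scale sigmaG D1 _); last by rewrite invr_ge0 ltW.
  apply: gauge_le => //; first by rewrite invr_ge0 ltW.
  by rewrite -ler_pdivrMr ?invr_gt0 // invrK mulrC.
have : C * sigma (F p)^-1 <= C * (D * sigma (F n)^-1) by apply: ler_wpM2l.
by rewrite mulrA; lra.
Qed.

End Ratio.

(** * Lengths of the intervals *)

Lemma nneseries_tail_le (R : realType) (u : nat -> R) (e : R) :
  (forall n, 0 <= u n) -> (\sum_(0 <= n <oo) (u n)%:E < +oo)%E -> 0 < e ->
  exists N, forall q, \sum_(N <= n < q) u n <= e.
Proof.
move=> u0 uoo e0.
have uE0 k : (0 <= (u k)%:E)%E by rewrite lee_fin.
have h : nbhs (0%E : \bar R) [set y | (y < e%:E)%E].
  by apply: open_nbhs_nbhs; split; [exact: open_ereal_lt_ereal|rewrite /= lte_fin].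
have [N _ hN] := @nneseries_tail_cvg _ _ xpredT uoo (fun k _ => uE0 k) _ h.
exists N => q; rewrite -lee_fin -sumEFin; apply/ltW.
have := hN N (leqnn N) => /=; apply: le_lt_trans.
by apply: nneseries_lim_ge => *; exact: uE0.
Qed.

(** Diagonal choice of a fast increasing sequence: past [m k], the [k]-th series
    contributes at most [2^-k]. *)
Lemma fast_sequence (R : realType) (u : nat -> nat -> R) :
  (forall k n, 0 <= u k n) ->
  (forall k, (\sum_(0 <= n <oo) (u k n)%:E < +oo)%E) ->
  exists m : nat -> nat, [/\ forall k, (m k < m k.+1)%N, (0 < m 0)%N
    & forall k q, \sum_(m k <= n < q) u k n <= 2^-1 ^+ k].
Proof.
move=> u0 uoo.
have /choice[N hN] k : exists N, forall q, \sum_(N <= n < q) u k n <= 2^-1 ^+ k.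
  by apply: nneseries_tail_le => //; rewrite exprn_gt0.
pose m k := (\sum_(j < k.+1) (N j).+1)%N.
have Nm k : (N k <= m k)%N by rewrite /m big_ord_recr /= addnS leqW // leq_addl.
exists m; split=> [k||k q].
- by rewrite /m [ltnRHS]big_ord_recr /= addnS ltnS leq_addr.
- by rewrite /m big_ord_recr /= addnS.
- case: (leqP q (m k)) => [qm|/ltnW mq].
    by rewrite big_geq // exprn_ge0.
  apply: le_trans (hN k q); rewrite [leRHS](@big_cat_nat _ _ _ (m k)) //=.
  by rewrite lerDr sumr_ge0.
Qed.

Section PowerOrbit.
Variables (G : groupType) (X : choiceType) (act : G -> X -> X).
Hypothesis actG : is_left_action act.
Variable S : set G.

Lemma power_orbit0 x : power_orbit act S 0 x x.
Proof.
have [act1 _] := actG; exists (fun=> 1%g); first by case.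
by rewrite big_ord0 act1.
Qed.

Lemma power_orbitS n x z : power_orbit act S n.+1 x z <->
  exists g y, [/\ S g, power_orbit act S n x y & z = act g y].
Proof.
have [_ actM] := actG; split.
  move=> [s Ss <-]; exists (s ord0), (act (\prod_(i < n) s (lift ord0 i))%g x).
  split=> //; first by exists (fun i => s (lift ord0 i)).
  by rewrite big_ord_recl actM.
move=> [g [y [Sg [s Ss <-] ->]]].
exists (fun i => if unlift ord0 i is Some j then s j else g).
  by move=> i /=; case: unliftP.
rewrite big_ord_recl actM unlift_none; congr (act _ (act _ _)).
by apply: eq_bigr => i _; rewrite liftK.
Qed.

Lemma power_orbit_finite n x : finite_set S -> finite_set (power_orbit act S n x).
Proof.
move=> finS; have [act1 _] := actG.
elim: n => [|n IH].
  apply: (@sub_finite_set _ _ [set x]); last exact: finite_set1.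
  by move=> z [s _ <-]; rewrite big_ord0 act1.
apply: (@sub_finite_set _ _ [set act g y | g in S & y in power_orbit act S n x]).
  by move=> z /power_orbitS[g [y [Sg hy ->]]]; exists g => //; exists y.
exact: finite_image2.
Qed.

Lemma power_orbit_le n p x z : S 1%g -> (n <= p)%N ->
  power_orbit act S n x z -> power_orbit act S p x z.
Proof.
move=> S1 /subnK <- h; have [act1 _] := actG.
elim: (p - n)%N => [//|d IH]; rewrite addSn; apply/power_orbitS.
by exists 1%g, z; rewrite act1.
Qed.

End PowerOrbit.

(** [reach act wX wG n x]: the point [x] is obtained by choosing a starting point
    [y], at cost [wX y], and applying successively elements [g] of the group, at
    cost [wG g] each, with total cost [n]. *)
Inductive reach (G X : Type) (act : G -> X -> X) (wX : X -> nat) (wG : G -> nat) :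
    nat -> X -> Prop :=
| reach_start x : reach act wX wG (wX x) x
| reach_step g n x : reach act wX wG n x -> reach act wX wG (wG g + n) (act g x).

Section Lengths.
Variables (R : realType) (G : groupType) (X : choiceType) (act : G -> X -> X).
Variables (F : nat -> R) (sigma : R -> R).
Hypotheses (actG : is_left_action act).
Hypotheses (countable_G : countable [set: G]) (countable_X : countable [set: X]).
Hypotheses (F_ge1 : forall n, 1 <= F n) (F_nd : nondecreasing_seq F).
Hypothesis F_summable : forall (S : set G) (x : X), finite_set S ->
    (\sum_(0 <= n <oo) ((card_power_orbit act S n x)%:R / F n)%:E < +oo)%E.

Let F_gt0 n : 0 < F n. Proof. exact: lt_le_trans (F_ge1 n). Qed.

(** A word-length-like function on the whole of [X] which every group element
    changes by a bounded amount and whose level sets are small enough for the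
    weights [1 / F] to be summable. It is the least cost of reaching a point, when
    the [k]-th point costs [m k], and the [k]-th group element and its inverse cost
    the same and at least [m k], for a rapidly increasing sequence [m]: below cost
    [m k.+1] only a finite set [Y k] of points and a finite set [S k] of group
    elements are available. *)
Lemma height_exists : exists ht : X -> nat,
  (forall g, exists j, forall x,
     (ht (act g x) <= ht x + j)%N /\ (ht x <= ht (act g x) + j)%N) /\
  (forall s : seq X, uniq s -> \sum_(x <- s) (F (ht x))^-1 <= 2).
Proof.
have [act1 actM] := actG.
have [iG iG_inj'] := countable_injP _ countable_G.
have [iX iX_inj'] := countable_injP _ countable_X.
have iG_inj : injective iG by move=> g h; apply: iG_inj'; rewrite inE.
have iX_inj : injective iX by move=> g h; apply: iX_inj'; rewrite inE.
pose S k : set G := [set g | (iG g <= k)%N] `|` [set 1%g].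
pose Y k : set X := [set y | (iX y <= k)%N].
have finS k : finite_set (S k).
  rewrite finite_setU; split; last exact: finite_set1.
  apply: (@sub_finite_set _ _ (iG @^-1` `I_k.+1)) => //.
  by apply: finite_preimage; [move=> ? ? _ _ /iG_inj|exact: finite_II].
have finY k : finite_set (Y k).
  apply: (@sub_finite_set _ _ (iX @^-1` `I_k.+1)) => //.
  by apply: finite_preimage; [move=> ? ? _ _ /iX_inj|exact: finite_II].
pose c k n := (\sum_(y <- fset_set (Y k)) card_power_orbit act (S k) n y)%N.
have c_sum k : (\sum_(0 <= n <oo) ((c k n)%:R / F n)%:E < +oo)%E.
  under eq_eseriesr do rewrite /c natr_sum mulr_suml -sumEFin.
  rewrite nneseries_sum; last by move=> y n _; rewrite lee_fin divr_ge0 // ltW.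
  by apply: lte_sum_pinfty => y _; exact: F_summable.
have [m [m_inc m0 m_tail]] :=
  fast_sequence (fun k n => divr_ge0 (ler0n R (c k n)) (ltW (F_gt0 n))) c_sum.
have m_homo a b : (a <= b)%N -> (m a <= m b)%N.
  by apply: (homo_leq (r := leq)) => [//|? ? ?|?]; [exact: leq_trans|exact: ltnW].
have m_lt a b : (m a < m b.+1)%N -> (a <= b)%N.
  by move=> h; rewrite leqNgt; apply/negP => /m_homo; rewrite leqNgt h.
have m_id k : (k < m k)%N by elim: k => // k IH; apply: leq_ltn_trans (m_inc k).
pose wX y := m (iX y).
pose wG g := m (maxn (iG g) (iG g^-1%g)).
have reachE n x : reach act wX wG n x -> (m 0 <= n)%N /\ forall k, (n < m k.+1)%N ->
    exists2 y, Y k y & power_orbit act (S k) n y x.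
  elim=> {n x} [x|g n x _ [n0 IH]]; split.
  - exact: m_homo.
  - move=> k /m_lt hk; exists x => //.
    by apply: (@power_orbit_le _ _ _ actG _ 0) => //; [right|exact: power_orbit0].
  - by rewrite (leq_trans n0) // leq_addl.
  - move=> k hk; have [|y Yy hy] := IH k; first exact: leq_ltn_trans (leq_addl _ _) hk.
    exists y => //; apply: (@power_orbit_le _ _ _ actG _ n.+1); first by right.
      by rewrite -addn1 addnC leq_add2r (leq_ltn_trans _ (m_id _)).
    apply/power_orbitS => //; exists g, x; split=> //; left => /=.
    have /m_lt := leq_ltn_trans (leq_addr _ _) hk.
    by apply: leq_trans; exact: leq_maxl.
have reach_ex x : exists n, `[< reach act wX wG n x >].
  by exists (wX x); apply/asboolP; constructor.
pose ht x := ex_minn (reach_ex x).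
have htP x : reach act wX wG (ht x) x.
  by rewrite /ht; case: ex_minnP => n /asboolP.
have ht_min n x : reach act wX wG n x -> (ht x <= n)%N.
  by move=> h; rewrite /ht; case: ex_minnP => p _; apply; apply/asboolP.
exists ht; split=> [g|s us].
  exists (wG g) => x; split.
    by apply: ht_min; rewrite addnC; constructor.
  apply: ht_min; rewrite addnC (_ : wG g = wG g^-1%g); last first.
    by rewrite /wG invgK maxnC.
  have := @reach_step _ _ act wX wG g^-1%g _ _ (htP (act g x)).
  by rewrite -actM mulVg act1.
have count_ht k n : (n < m k.+1)%N -> (count (fun x => ht x == n) s <= c k n)%N.
  move=> nk; rewrite -size_filter.
  apply: (@leq_trans (size (flatten [seq (fset_set (power_orbit act (S k) n y) : seq X)
     | y <- fset_set (Y k)]))).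
    apply: uniq_leq_size; first exact: filter_uniq.
    move=> x; rewrite mem_filter => /andP[/eqP htx _].
    have [_ h] := reachE _ _ (htP x); rewrite htx in h; have [y Yy hy] := h k nk.
    apply/flatten_mapP; exists y; first by rewrite in_fset_set ?inE.
    by rewrite in_fset_set ?inE //; exact: power_orbit_finite.
  by rewrite size_flatten sumnE /shape !big_map.
(* each range of heights is dominated by a tail of a single summable series *)
have block k : \sum_(x <- s | (m k <= ht x < m k.+1)%N) (F (ht x))^-1 <= 2^-1 ^+ k.
  apply: le_trans (m_tail k (m k.+1)).
  have indic x : (if (m k <= ht x < m k.+1)%N then (F (ht x))^-1 else 0) =
      \sum_(m k <= n < m k.+1) if ht x == n then (F n)^-1 else 0.
    rewrite -big_mkcond /= (eq_bigl (fun n => n == ht x)) => [|n].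
      by rewrite big_nat1_eq.
    exact: eq_sym.
  rewrite big_mkcond (eq_bigr _ (fun x _ => indic x)) exchange_big /= !big_nat.
  apply: ler_sum => n /andP[_ nk]; rewrite -big_mkcond /= big_const_seq.
  rewrite iter_addr_0 -[leLHS]mulr_natl.
  by rewrite ler_wpM2r ?invr_ge0 ?(ltW (F_gt0 n)) // ler_nat count_ht.
have partial k : \sum_(x <- s | (ht x < m k)%N) (F (ht x))^-1 <=
    \sum_(j < k) 2^-1 ^+ j.
  elim: k => [|k IH].
    rewrite big_ord0 big_pred0 // => x.
    by have [h _] := reachE _ _ (htP x); apply/negbTE; rewrite -leqNgt.
  rewrite big_ord_recr /= (bigID (fun x => (ht x < m k)%N)) /= lerD //.
    rewrite (eq_bigl (fun x => (ht x < m k)%N)) // => x.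
    by apply: andb_idl => /ltn_trans; apply.
  rewrite (eq_bigl (fun x => (m k <= ht x < m k.+1)%N)) // => x.
  by rewrite -leqNgt andbC.
have geom k : \sum_(j < k) (2^-1 : R) ^+ j = 2 - 2 * 2^-1 ^+ k.
  elim: k => [|k IH]; first by rewrite big_ord0 expr0; lra.
  by rewrite big_ord_recr /= IH exprS; field.
pose K := (\max_(x <- s) ht x)%N.
rewrite (eq_big_seq (fun x => if (ht x < m K)%N then (F (ht x))^-1 else 0)).
  rewrite -big_mkcond /=; apply: le_trans (partial K) _; rewrite geom.
  by rewrite gerBl mulr_ge0 // exprn_ge0.
move=> x xs; rewrite ifT // (leq_ltn_trans _ (m_id K)) //.
exact: leq_bigmax_seq.
Qed.

(** Lengths with total 1 that every group element distorts by a factor within a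
    multiple of [sigma (l x)] of 1. *)
Lemma lengths_exist (x0 : X) (sigmaG : gauge sigma)
  (F_sigma : (limn_esup (fun n =>
    (`|F n.+1 / F n - 1| * (1 / sigma ((F n)^-1)))%:E) < +oo)%E) :
  exists l : X -> R, [/\ forall x, 0 < l x, nsummable l, nsum l = 1
    & forall g, exists2 C, 0 <= C &
        forall x, `|l (act g x) / l x - 1| <= C * sigma (l x)].
Proof.
have [ht [ht_shift ht_sum]] := height_exists.
pose l0 x := (F (ht x))^-1.
have l0_gt0 x : 0 < l0 x by rewrite invr_gt0.
have l0_sum : nsummable l0 by apply: nsummable_fin ht_sum => x; exact/ltW/l0_gt0.
pose A := nsum l0; have A0 : 0 < A by exact: lt_le_trans (l0_gt0 x0) (nsum_ge x0 l0_sum).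
have iA0 : 0 <= A^-1 by rewrite invr_ge0 ltW.
exists (fun x => A^-1 * l0 x); split=> [x|||g].
- by rewrite mulr_gt0 // invr_gt0.
- exact: nsummableZ.
- by rewrite nsumZ // mulVf // gt_eqF.
have [j hj] := ht_shift g.
have [C C0 hC] := ratio_shift sigmaG F_ge1 F_nd F_sigma j.
pose B := Num.max 1 A; have B1 : 1 <= B by rewrite le_max lexx.
exists (C * B) => [|x]; first by rewrite mulr_ge0 // (le_trans _ B1).
have [h1 h2] := hj x; have := hC _ _ h2 h1.
have -> : F (ht x) / F (ht (act g x)) = A^-1 * l0 (act g x) / (A^-1 * l0 x).
  rewrite /l0; field; rewrite !gt_eqF //.
move=> /le_trans; apply; rewrite -mulrA ler_wpM2l //.
have l1 : 0 <= A^-1 * l0 x by rewrite mulr_ge0 // ltW.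
apply: le_trans (gauge_scale sigmaG B1 l1).
apply: gauge_le; rewrite // -/(l0 x) ?(ltW (l0_gt0 x)) //.
rewrite mulrA ler_peMl ?(ltW (l0_gt0 x)) // ler_pdivlMr ?mul1r //.
by rewrite le_max lexx orbT.
Qed.

End Lengths.

(** * Cutting a circular order *)

Section CyclicToLinear.
Variables (X : choiceType) (c : X -> X -> X -> int) (x0 : X).
Hypothesis c_co : circular_order c.

(** The linear order with least element [x0] obtained by cutting the circular
    order at [x0]. *)
Definition cut_lt (x y : X) : bool := (x != y) && ((x == x0) || (c x0 x y == 1)).

Let c_cut x y z : c x y z = c x0 y z - c x0 x z + c x0 x y.
Proof. by case: c_co => _ _ /(_ x0 x y z); lia. Qed.

Let c_cases x y z : [\/ c x y z = 0, c x y z = 1 | c x y z = -1].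
Proof.
case: c_co => /(_ x y z); rewrite !inE => /or3P[]/eqP-> _ _;
  by [constructor 1|constructor 2|constructor 3].
Qed.

Let c_ne0 x y z : x != y -> x != z -> y != z -> c x y z = 1 \/ c x y z = -1.
Proof.
move=> /eqP xy /eqP xz /eqP yz; case: (c_cases x y z) => [h||]; [|by left|by right].
by case: c_co => _ /(_ x y z)[/(_ h)[]].
Qed.

Let c_eq0 x y z : [\/ x = y, x = z | y = z] -> c x y z = 0.
Proof. by move=> h; case: c_co => _ hz _; apply/hz. Qed.

Let c0_anti x y : c x0 y x = - c x0 x y.
Proof.
have := c_cut x y x; rewrite (c_eq0 (Or32 _ _ (erefl x))) (@c_eq0 x0 x x); last exact: Or33.
by lia.
Qed.

Lemma circular_anti x y z : c x z y = - c x y z.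
Proof. by rewrite c_cut [in RHS]c_cut (c0_anti y z); lia. Qed.

Lemma cut_lt_irr x : cut_lt x x = false.
Proof. by rewrite /cut_lt eqxx. Qed.

Lemma cut_lt_min x : x != x0 -> cut_lt x0 x.
Proof. by rewrite /cut_lt eqxx eq_sym => ->. Qed.

Let cut_ltE x y : x != x0 -> cut_lt x y = (c x0 x y == 1).
Proof.
rewrite /cut_lt => /negbTE -> /=; case: eqVneq => //= ->.
by rewrite (@c_eq0 x0 y y) //; exact: Or33.
Qed.

Let cut_lt0 x : cut_lt x x0 = false.
Proof.
case: (eqVneq x x0) => [->|h]; first exact: cut_lt_irr.
by rewrite cut_ltE // (@c_eq0 x0 x x0) //; exact: Or32.
Qed.

Lemma cut_lt_anti x y : cut_lt x y -> cut_lt y x = false.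
Proof.
case: (eqVneq x x0) => [->|hx]; first by rewrite cut_lt0.
case: (eqVneq y x0) => [->|hy]; first by rewrite cut_lt0.
by rewrite !cut_ltE // (c0_anti x y) => /eqP ->.
Qed.

Lemma cut_lt_total x y : x != y -> cut_lt x y || cut_lt y x.
Proof.
move=> xy; case: (eqVneq x x0) => [ex|hx].
  by rewrite ex cut_lt_min // -ex eq_sym.
case: (eqVneq y x0) => [ey|hy]; first by rewrite ey cut_lt_min ?orbT // -ey.
rewrite !cut_ltE // (c0_anti x y).
by case: (@c_ne0 x0 x y); rewrite // 1?eq_sym // => ->.
Qed.

Lemma cut_lt_trans x y z : cut_lt x y -> cut_lt y z -> cut_lt x z.
Proof.
case: (eqVneq y x0) => [->|hy]; first by rewrite cut_lt0.
case: (eqVneq z x0) => [->|hz]; first by rewrite cut_lt0.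
case: (eqVneq x x0) => [-> _ _|hx]; first exact: cut_lt_min.
rewrite !cut_ltE // => /eqP h1 /eqP h2.
have := c_cases x y z; rewrite (c_cut x y z) h1 h2.
by case: (c_cases x0 x z) => -> // [].
Qed.

Lemma circular_cut x y z : c x y z = 1 <->
  [\/ cut_lt x y /\ cut_lt y z, cut_lt y z /\ cut_lt z x | cut_lt z x /\ cut_lt x y].
Proof.
suff : (c x y z == 1) =
  [|| cut_lt x y && cut_lt y z, cut_lt y z && cut_lt z x | cut_lt z x && cut_lt x y].
  move=> e; split=> [/eqP|h]; last by apply/eqP; rewrite e; apply/or3P;
    by case: h => h; [constructor 1|constructor 2|constructor 3]; apply/andP.
  by rewrite e => /or3P[]/andP h; [constructor 1|constructor 2|constructor 3].
have anti2 p q : cut_lt p q && cut_lt q p = false.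
  by case: (boolP (cut_lt p q)) => // /cut_lt_anti ->.
case: (eqVneq x y) => [<-|xy].
  by rewrite c_eq0 ?cut_lt_irr ?andbF ?anti2 //; constructor 1.
case: (eqVneq x z) => [<-|xz].
  by rewrite c_eq0 ?cut_lt_irr ?andbF ?anti2 //; constructor 2.
case: (eqVneq y z) => [<-|yz].
  by rewrite c_eq0 ?cut_lt_irr ?andbF ?anti2 //; constructor 3.
case: (eqVneq x x0) => [ex|hx].
  subst x; have hy : y != x0 by rewrite eq_sym.
  have hz : z != x0 by rewrite eq_sym.
  by rewrite !cut_lt0 !cut_lt_min // cut_ltE // !andbF !orbF.
case: (eqVneq y x0) => [ey|hy].
  subst y; have hz : z != x0 by rewrite eq_sym.
  rewrite !cut_lt0 !cut_lt_min // !cut_ltE // andbF orbF /= c_cut (c0_anti x z).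
  rewrite (@c_eq0 x0 x0 z) ?(@c_eq0 x0 x x0); [|by constructor 2|by constructor 1].
  by rewrite add0r addr0.
case: (eqVneq z x0) => [ez|hz].
  subst z; rewrite !cut_lt0 !cut_lt_min // !cut_ltE // andbF /= c_cut.
  rewrite (@c_eq0 x0 y x0) ?(@c_eq0 x0 x x0); [|by constructor 2|by constructor 2].
  by rewrite subr0 add0r.
rewrite !cut_ltE // c_cut (c0_anti x z).
have n0 := (eq_sym x0).
have := @c_ne0 x0 x y; have := @c_ne0 x0 y z; have := @c_ne0 x0 x z.
rewrite !n0 => /(_ hx hz xz) hxz /(_ hy hz yz) hyz /(_ hx hy xy) hxy.
have := c_cases x y z; rewrite c_cut.
by case: hxz hyz hxy => -> [] -> [] -> // [].
Qed.

(** Cutting elsewhere: the image of an initial segment under a circular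
    automorphism is a circular interval starting at the image of [x0]. *)
Lemma cut_lt_image (g : X -> X) (z x : X) : injective g ->
  (forall x y z, c (g x) (g y) (g z) = c x y z) -> cut_lt z x =
  if cut_lt (g x0) (g x) then ~~ cut_lt (g z) (g x0) && cut_lt (g z) (g x)
  else (x != x0) && (~~ cut_lt (g z) (g x0) || cut_lt (g z) (g x)).
Proof.
move=> g_inj cg.
case: (eqVneq x x0) => [->|xx0]; first by rewrite cut_lt0 cut_lt_irr.
have gx : g x != g x0 by rewrite (inj_eq g_inj).
case: (eqVneq z x0) => [->|zx0].
  by rewrite cut_lt_irr /= cut_lt_min //; case: ifP.
have gz : g z != g x0 by rewrite (inj_eq g_inj).
rewrite cut_ltE // -cg.
have -> : (c (g x0) (g z) (g x) == 1) = [|| cut_lt (g x0) (g z) && cut_lt (g z) (g x),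
    cut_lt (g z) (g x) && cut_lt (g x) (g x0) | cut_lt (g x) (g x0) && cut_lt (g x0) (g z)].
  apply/eqP/or3P => [/circular_cut[] h|h].
  - by constructor 1; apply/andP.
  - by constructor 2; apply/andP.
  - by constructor 3; apply/andP.
  - by apply/circular_cut; case: h => /andP h; [constructor 1|constructor 2|constructor 3].
have tot_x := cut_lt_total gx; have tot_z := cut_lt_total gz.
have anti_x : ~~ (cut_lt (g x) (g x0) && cut_lt (g x0) (g x)).
  by apply/negP => /andP[/cut_lt_anti ->].
have anti_z : ~~ (cut_lt (g z) (g x0) && cut_lt (g x0) (g z)).
  by apply/negP => /andP[/cut_lt_anti ->].
have tr1 : cut_lt (g z) (g x0) && cut_lt (g x0) (g x) ==> cut_lt (g z) (g x).
  by apply/implyP => /andP[]; exact: cut_lt_trans.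
have tr2 : cut_lt (g z) (g x) && cut_lt (g x) (g x0) ==> cut_lt (g z) (g x0).
  by apply/implyP => /andP[]; exact: cut_lt_trans.
move: tot_x tot_z anti_x anti_z tr1 tr2.
by case: (cut_lt (g x) (g x0)); case: (cut_lt (g x0) (g x));
  case: (cut_lt (g z) (g x0)); case: (cut_lt (g x0) (g z));
  case: (cut_lt (g z) (g x)).
Qed.

End CyclicToLinear.

(** * Placing the intervals *)

Lemma seq_argmax (R : realDomainType) (T : eqType) (s : seq T) (P : pred T)
    (f : T -> R) : has P s ->
  exists z, [/\ z \in s, P z & forall y, y \in s -> P y -> f y <= f z].
Proof.
elim: s => //= x s IH; case: (boolP (has P s)) => [/IH[z [zs Pz hz]] _|hs].
  case: (boolP (P x && (f z <= f x))) => [/andP[Px zx]|h].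
    exists x; split=> [|//|y]; first by rewrite mem_head.
    by rewrite inE => /orP[/eqP ->//|ys Py]; apply: le_trans (hz _ ys Py) zx.
  exists z; split=> [|//|y]; first by rewrite inE zs orbT.
  rewrite inE => /orP[/eqP -> Px|]; last exact: hz.
  by move: h; rewrite Px /= -ltNge => /ltW.
rewrite orbF => Px; exists x; split=> [|//|y]; first by rewrite mem_head.
rewrite inE => /orP[/eqP ->//|ys Py].
by case/hasP: hs; exists y.
Qed.

(** If [p - q] differs from [u - v] by at most [e * (u - v)] termwise, then so do
    the sums. *)
Lemma nsum_abs (R : realType) (X : choiceType) (p q u v : X -> R) e : 0 <= e ->
  nsummable p -> nsummable q -> nsummable u -> nsummable v ->
  (forall y, `|p y - q y - (u y - v y)| <= e * (u y - v y)) ->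
  `|nsum p - nsum q - (nsum u - nsum v)| <= e * (nsum u - nsum v).
Proof.
move=> e0 sp sq su sv h.
have e1 : 0 <= 1 + e by lra.
have h1 : nsum p + (1 + e) * nsum v <= nsum q + (1 + e) * nsum u.
  rewrite -!nsumZ // -!nsumD //; try exact: nsummableZ.
  apply: nsum_le => [||y]; try by apply: nsummableD => //; exact: nsummableZ.
  by have := h y; rewrite ler_norml => /andP[]; lra.
have h2 : nsum q + (nsum u + e * nsum v) <= nsum p + (nsum v + e * nsum u).
  rewrite -!nsumZ // -!nsumD //; try (by apply: nsummableZ); try (by apply: nsummableD => //; exact: nsummableZ).
  apply: nsum_le => [||y].
  - by apply: nsummableD => //; apply: nsummableD => //; exact: nsummableZ.
  - by apply: nsummableD => //; apply: nsummableD => //; exact: nsummableZ.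
  by have := h y; rewrite ler_norml => /andP[]; lra.
by rewrite ler_norml; apply/andP; split; lra.
Qed.

Section Placement.
Variables (R : realType) (X : choiceType) (c : X -> X -> X -> int) (x0 : X).
Variable (l : X -> R).
Hypotheses (c_co : circular_order c) (l_gt0 : forall x, 0 < l x).
Hypotheses (l_sum : nsummable l) (l_1 : nsum l = 1).

Local Notation lt := (cut_lt c x0).

Let ind (P : pred X) (y : X) : R := if P y then l y else 0.

Let ind_ge0 P y : 0 <= ind P y.
Proof. by rewrite /ind; case: ifP => // _; exact: ltW. Qed.

Let ind_sum P : nsummable (ind P).
Proof.
apply: nsummable_le l_sum => // y; rewrite /ind; case: ifP => // _; exact: ltW.
Qed.

(** Left endpoint of the interval of [x]: total length of the intervals that
    precede it. *)
Definition pos (x : X) : R := nsum (fun y => if lt y x then l y else 0).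

Lemma pos_ge0 x : 0 <= pos x.
Proof. exact/nsum_ge0/(ind_sum (fun y => lt y x)). Qed.

Let nsum_ind2 P x : nsum (fun y => ind P y + ind (pred1 x) y) = nsum (ind P) + l x.
Proof.
rewrite nsumD //; congr (_ + _); rewrite -[RHS](@nsum_delta R _ x (l x)) ?(ltW (l_gt0 x)) //.
by apply: eq_Sm => y; rewrite /ind /=; case: eqP => [->|].
Qed.

Lemma pos_lt x y : lt x y -> pos x + l x <= pos y.
Proof.
move=> xy; rewrite /pos -[nsum _]/(nsum (ind (fun z => lt z x))) -nsum_ind2.
apply: nsum_le; [exact: nsummableD|exact: (ind_sum (fun z => lt z y))|move=> z].
rewrite /ind /=; case: (eqVneq z x) => [->|zx].
  by rewrite cut_lt_irr xy add0r.
rewrite addr0; case: ifP => [zltx|_]; last by case: ifP => // _; exact: ltW.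
by rewrite (cut_lt_trans c_co zltx xy).
Qed.

Let after (x : X) := nsum (ind (fun y => lt x y)).

Let pos_after x : pos x + l x + after x = 1.
Proof.
rewrite /pos -[nsum _]/(nsum (ind (fun z => lt z x))) -nsum_ind2 /after -nsumD //; last exact: nsummableD.
rewrite -l_1; apply: eq_Sm => y; rewrite /ind /=.
case: (eqVneq y x) => [->|yx]; first by rewrite cut_lt_irr add0r addr0.
have := cut_lt_total x0 c_co yx; rewrite addr0.
case: (boolP (lt y x)) => [/(cut_lt_anti c_co) -> _|_ /= ->]; first by rewrite addr0.
by rewrite add0r.
Qed.

Lemma pos_le1 x : pos x + l x <= 1.
Proof. by have := pos_after x; have := nsum_ge0 (ind_sum (fun y => lt x y)); rewrite -/(after x); lra. Qed.

Lemma l_le1 x : l x <= 1.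
Proof. by have := pos_ge0 x; have := pos_le1 x; lra. Qed.

(** Length of the part of the interval of [x] that lies in [[0, t]]. *)
Definition cl (t : R) (x : X) : R := Num.max 0 (Num.min (t - pos x) (l x)).

Lemma cl_left t x : t <= pos x -> cl t x = 0.
Proof.
by move=> h; rewrite /cl max_l // ge_min; apply/orP; left; lra.
Qed.

Lemma cl_right t x : pos x + l x <= t -> cl t x = l x.
Proof.
by move=> h; have lx := l_gt0 x; rewrite /cl min_r ?max_r //; [exact: ltW|lra].
Qed.

Lemma cl_mid t x : pos x <= t -> t <= pos x + l x -> cl t x = t - pos x.
Proof. by move=> h h2; rewrite /cl min_l ?max_r //; lra. Qed.

Lemma cl_ge0 t x : 0 <= cl t x.
Proof. by rewrite /cl le_max lexx. Qed.

Lemma cl_le t x : cl t x <= l x.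
Proof. by rewrite /cl ge_max ge_min lexx orbT ltW. Qed.

Lemma cl_sum t : nsummable (cl t).
Proof. by apply: nsummable_le l_sum => x; [exact: cl_ge0|exact: cl_le]. Qed.

Let cl_cases t x : [\/ t <= pos x /\ cl t x = 0, pos x + l x <= t /\ cl t x = l x
  | [/\ pos x < t, t < pos x + l x & cl t x = t - pos x]].
Proof.
case: (leP t (pos x)) => h1; first by constructor 1; rewrite cl_left.
case: (leP (pos x + l x) t) => h2; first by constructor 2; rewrite cl_right.
by constructor 3; rewrite cl_mid // ltW.
Qed.

Lemma cl_lip s t x : s <= t -> 0 <= cl t x - cl s x <= t - s.
Proof.
have lx := l_gt0 x => st.
by case: (cl_cases s x) => -[] => [h1 ->|h1 ->|h1 h2 ->];
  case: (cl_cases t x) => -[] => [h3 ->|h3 ->|h3 h4 ->]; apply/andP; split; lra.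
Qed.

(** The intervals fill [[0, 1]] up to a negligible set. *)
Lemma cl_total t : 0 <= t -> t <= 1 -> nsum (cl t) = t.
Proof.
move=> t0 t1; apply/eqP; rewrite eq_le; apply/andP; split.
  apply: nsum_fin_le => [x|s us]; first exact: cl_ge0.
  (* the last interval of [s] that starts before [t] *)
  case: (boolP (has (fun y => pos y < t) s)) => [/(seq_argmax pos)[z [zs zt zmax]]|hs].
    apply: (@le_trans _ _ (pos z + cl t z)); last first.
      by case: (cl_cases t z) => -[]; lra.
    have -> : pos z + cl t z = nsum (fun y => ind (fun y => lt y z) y
        + if y == z then cl t z else 0).
      by rewrite nsumD ?nsum_delta ?cl_ge0 //; apply: nsummable_delta; exact: cl_ge0.
    apply: le_trans (nsum_ge_fin _ us); last first.
      by apply: nsummableD => //; apply: nsummable_delta; exact: cl_ge0.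
    rewrite big_seq [leRHS]big_seq; apply: ler_sum => y ys.
    rewrite /ind; case: (eqVneq y z) => [->|yz]; first by rewrite cut_lt_irr add0r.
    rewrite addr0; case/orP: (cut_lt_total x0 c_co yz) => [->|zy]; first exact: cl_le.
    rewrite (cut_lt_anti c_co zy) cl_left // leNgt; apply/negP => yt.
    by have := zmax y ys yt; have := pos_lt zy; have := l_gt0 z; lra.
  rewrite big_seq big1 // => y ys; rewrite cl_left // leNgt; apply/negP => yt.
  by case/hasP: hs; exists y.
have rest_sum : nsummable (fun y => l y - cl t y).
  apply: nsummable_le l_sum => y; first by rewrite subr_ge0 cl_le.
  by rewrite gerBl cl_ge0.
suff : nsum (fun y => l y - cl t y) <= 1 - t.
  have : nsum (fun y => (l y - cl t y) + cl t y) = 1.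
    by rewrite -l_1; apply: eq_Sm => y; rewrite subrK.
  by rewrite nsumD //; [lra|exact: cl_sum].
apply: nsum_fin_le => [x|s us]; first by rewrite subr_ge0 cl_le.
(* the first interval of [s] that ends after [t] *)
case: (boolP (has (fun y => t < pos y + l y) s)) =>
    [/(seq_argmax (fun y => - pos y))[z [zs zt zmax]]|hs].
  have zrest : 0 <= l z - cl t z by rewrite subr_ge0 cl_le.
  apply: (@le_trans _ _ (after z + (l z - cl t z))); last first.
    have := pos_after z; case: (cl_cases t z) => -[]; lra.
  have -> : after z + (l z - cl t z) = nsum (fun y => ind (fun y => lt z y) y
      + if y == z then l z - cl t z else 0).
    by rewrite nsumD ?nsum_delta //; exact: nsummable_delta.
  apply: le_trans (nsum_ge_fin _ us); last by apply: nsummableD => //; exact: nsummable_delta.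
  rewrite big_seq [leRHS]big_seq; apply: ler_sum => y ys.
  rewrite /ind; case: (eqVneq y z) => [->|yz]; first by rewrite cut_lt_irr add0r.
  rewrite addr0; case/orP: (cut_lt_total x0 c_co yz) => [yz'|->]; last first.
    by rewrite gerBl cl_ge0.
  rewrite (cut_lt_anti c_co yz') cl_right ?subrr // leNgt; apply/negP => yt.
  by have := zmax y ys yt; have := pos_lt yz'; have := l_gt0 y; lra.
rewrite big_seq big1 ?subr_ge0 // => y ys; rewrite cl_right ?subrr // leNgt.
by apply/negP => yt; case/hasP: hs; exists y.
Qed.

(** A gap [[u, v]] free of intervals would contribute nothing to [cl_total]. *)
Lemma pos_dense u v : 0 <= u -> u < v -> v <= 1 ->
  exists x t, [/\ pos x < t, t < pos x + l x, u < t & t < v].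
Proof.
move=> u0 uv v1; apply: contrapT => h.
suff e : cl u = cl v by have := cl_total u0 ltac:(lra); rewrite e cl_total; lra.
apply/funext => x; have lx := l_gt0 x.
have [h1|h1] := leP (pos x + l x) u.
  by rewrite !cl_right //; lra.
have [h2|h2] := leP v (pos x).
  by rewrite !cl_left //; lra.
exfalso; apply: h; exists x.
exists ((Num.max u (pos x) + Num.min v (pos x + l x)) / 2).
have m1 : u <= Num.max u (pos x) by rewrite le_max lexx.
have m2 : pos x <= Num.max u (pos x) by rewrite le_max lexx orbT.
have m3 : Num.min v (pos x + l x) <= v by rewrite ge_min lexx.
have m4 : Num.min v (pos x + l x) <= pos x + l x by rewrite ge_min lexx orbT.
have m5 : Num.max u (pos x) < Num.min v (pos x + l x).
  by rewrite lt_min !gt_max; apply/andP; split; apply/andP; split; lra.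
by split; lra.
Qed.

End Placement.

(** * The circle maps on a fundamental domain *)

Section Taylor.
Variables (R : realType) (sigma : R -> R).
Hypothesis sigmaG : gauge sigma.
Implicit Types (f : R -> R) (K t s d e : R).

(** [taylor f K t d s]: first order expansion of [f] at [t] with slope [d],
    evaluated at [s], with an error controlled by the gauge. *)
Definition taylor f K t d s :=
  `|f s - f t - d * (s - t)| <= K * sigma `|s - t| * `|s - t|.

Lemma taylor_le f K K' t d s : K <= K' -> taylor f K t d s -> taylor f K' t d s.
Proof.
move=> KK h; apply: le_trans h _; rewrite -!mulrA ler_wpM2r //.
by rewrite mulr_ge0 // gauge_ge0.
Qed.

(** Comparing the expansions at two points with one another bounds the
    difference of the slopes: this is how the regularity of the derivative is
    obtained. *)
Lemma taylor_swap f K t d s d' : s != t -> taylor f K t d s ->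
  taylor f K s d' t -> `|d - d'| <= 2 * K * sigma `|s - t|.
Proof.
rewrite /taylor => st h1; rewrite (distrC t s) => h2.
have n0 : 0 < `|s - t| by rewrite normr_gt0 subr_eq0.
rewrite -(ler_pM2r n0) -normrM.
have -> : (d - d') * (s - t) = - (f s - f t - d * (s - t)) - (f t - f s - d' * (t - s)).
  by ring.
apply: le_trans (ler_normB _ _) _; rewrite normrN; lra.
Qed.

(** [e] lies between [t] and [s], in either direction. *)
Definition between t e s := (t <= e <= s) || (s <= e <= t).

(** Expansions on both sides of an intermediate point of slope 1 combine; the slope
    at [t] is then close to 1 by [taylor_swap]. *)
Lemma taylor_chain f K t d e s : 0 <= K -> between t e s ->
  taylor f K t d e -> taylor f K e 1 t -> taylor f K e 1 s -> (e = t -> d = 1) ->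
  taylor f (3 * K) t d s.
Proof.
move=> K0 bt h1 h1' h2 h4; rewrite /taylor.
have dist : `|s - t| = `|e - t| + `|s - e|.
  case/orP: bt => /andP[a b]; last first.
    by rewrite !ler0_norm; lra.
  by rewrite !ger0_norm; lra.
have n1 := normr_ge0 (e - t); have n2 := normr_ge0 (s - e).
have g1 : sigma `|e - t| <= sigma `|s - t| by apply: gauge_le => //; lra.
have g2 : sigma `|s - e| <= sigma `|s - t| by apply: gauge_le => //; lra.
have g0 : 0 <= sigma `|s - t| by apply: gauge_ge0.
have h3' : `|d - 1| <= 2 * K * sigma `|s - t|.
  case: (eqVneq e t) => [/h4 ->|et]; first by rewrite subrr normr0 !mulr_ge0.
  apply: le_trans (taylor_swap et h1 h1') _.
  by apply: ler_wpM2l => //; rewrite mulr_ge0.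
have -> : f s - f t - d * (s - t) = (f e - f t - d * (e - t))
  + (f s - f e - 1 * (s - e)) - (d - 1) * (s - e) by ring.
apply: le_trans (ler_normB _ _) _; rewrite [in leLHS]normrM.
have p1 : `|f e - f t - d * (e - t)| <= K * sigma `|s - t| * `|e - t|.
  by apply: le_trans h1 _; apply: ler_wpM2r => //; exact: ler_wpM2l.
have p2 : `|f s - f e - 1 * (s - e)| <= K * sigma `|s - t| * `|s - e|.
  by apply: le_trans h2 _; apply: ler_wpM2r => //; exact: ler_wpM2l.
have p3 : `|d - 1| * `|s - e| <= 2 * K * sigma `|s - t| * `|s - e|.
  exact: ler_wpM2r.
have p4 := ler_normD (f e - f t - d * (e - t)) (f s - f e - 1 * (s - e)).
have p5 : 0 <= K * sigma `|s - t| * `|e - t| by rewrite !mulr_ge0.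
rewrite [X in _ <= _ * X]dist. apply: (le_trans (lerD (le_trans p4 (lerD p1 p2)) p3)). lra.
Qed.

End Taylor.

Section CircleMap.
Variables (R : realType) (X : choiceType) (c : X -> X -> X -> int) (x0 : X).
Variables (l : X -> R) (sigma : R -> R) (g f : X -> X) (M C : R).
Hypotheses (c_co : circular_order c) (l_gt0 : forall x, 0 < l x).
Hypotheses (l_sum : nsummable l) (l_1 : nsum l = 1) (sigmaG : gauge sigma).
Hypotheses (gK : cancel g f) (fK : cancel f g).
Hypothesis g_c : forall x y z, c (g x) (g y) (g z) = c x y z.
Hypotheses (M1 : 1 <= M) (C0 : 0 <= C).
Hypotheses (gM : forall x, l (g x) <= M * l x) (Mg : forall x, l x <= M * l (g x)).
Hypothesis g_gauge : forall x, `|l (g x) / l x - 1| <= C * sigma (l x).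

Local Notation lt := (cut_lt c x0).
Local Notation pos := (pos c x0 l).
Local Notation cl := (cl c x0 l).
Let K := 4 * M ^+ 4 * C.

Let K0 : 0 <= K.
Proof. by rewrite /K mulr_ge0 // mulr_ge0 // exprn_ge0 // (le_trans _ M1). Qed.

Let piece (t : R) (y : X) := ivmap (l y) (l (g y)) (cl t y).

Let piece_itv t y : 0 <= piece t y <= l (g y).
Proof. by apply: ivmap_itv => //; [exact: cl_ge0|exact: cl_le]. Qed.

Let lg_sum : nsummable (fun y => l (g y)).
Proof. exact: nsummable_bij gK fK l_sum. Qed.

Let piece_sum t : nsummable (piece t).
Proof. by apply: nsummable_le lg_sum => y; have /andP[] := piece_itv t y. Qed.

(** The map of the circle induced by [g], on the fundamental domain [[0, 1]]: the
    interval of [x] is sent to the interval of [g x]. *)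
Definition cmap (t : R) : R := pos (g x0) + nsum (piece t).

Lemma cmap0 : cmap 0 = pos (g x0).
Proof.
rewrite /cmap (eq_Sm (v := fun=> 0)) ?nsum0 ?addr0 // => y.
by rewrite /piece cl_left ?ivmap0 //; exact: pos_ge0.
Qed.

Lemma cmap1 : cmap 1 = pos (g x0) + 1.
Proof.
rewrite /cmap (eq_Sm (v := fun y => l (g y))) ?(nsum_bij _ gK fK) ?l_1 // => y.
by rewrite /piece cl_right ?ivmap_end //; exact: pos_le1.
Qed.

Lemma cmap_mid x v : 0 <= v -> v <= l x ->
  cmap (pos x + v) = cmap (pos x) + ivmap (l x) (l (g x)) v.
Proof.
move=> v0 vl; have iv0 : 0 <= ivmap (l x) (l (g x)) v.
  by have /andP[] := ivmap_itv (l_gt0 x) (l_gt0 (g x)) v0 vl.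
rewrite /cmap -addrA; congr (_ + _).
rewrite -[ivmap _ _ v in RHS](nsum_delta x iv0) -nsumD //; last exact: nsummable_delta.
apply: eq_Sm => y; rewrite /piece; case: (eqVneq y x) => [->|yx].
  rewrite cl_mid ?lerDl ?lerD2l // cl_left // ivmap0 // add0r.
  by rewrite addrC addKr.
rewrite addr0; case/orP: (cut_lt_total x0 c_co yx) => h.
  by have := pos_lt c_co l_gt0 l_sum h => h2; rewrite !cl_right //; lra.
by have := pos_lt c_co l_gt0 l_sum h => h2; rewrite !cl_left //; lra.
Qed.

(** Left endpoints are sent to left endpoints, modulo integers. *)
Lemma cmap_pos x : cmap (pos x) = pos (g x) \/ cmap (pos x) = pos (g x) + 1.
Proof.
have ginj := can_inj gK.
have pE y : piece (pos x) y = if lt y x then l (g y) else 0.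
  rewrite /piece; case: (boolP (lt y x)) => [h|h].
    by rewrite cl_right ?ivmap_end //; exact: pos_lt.
  rewrite cl_left ?ivmap0 //; case: (eqVneq y x) => [->//|yx].
  have := cut_lt_total x0 c_co yx; rewrite (negbTE h) /= => h2.
  by have := pos_lt c_co l_gt0 l_sum h2; have := l_gt0 x; lra.
have ind_sum (P : pred X) : nsummable (fun y => if P y then l y else 0).
  apply: nsummable_le l_sum => y; case: ifP => // _; exact: ltW.
pose Q z := if lt (g x0) (g x) then ~~ lt z (g x0) && lt z (g x)
  else (x != x0) && (~~ lt z (g x0) || lt z (g x)).
have -> : cmap (pos x) = pos (g x0) + nsum (fun z => if Q z then l z else 0).
  rewrite /cmap -[in RHS](nsum_bij _ gK fK); congr (_ + _); apply: eq_Sm => y.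
  by rewrite pE (cut_lt_image x0 c_co y x ginj g_c).
rewrite /pos -nsumD //; try exact: (ind_sum Q); try exact: (ind_sum (fun z => lt z _)).
rewrite /Q; case: (boolP (lt (g x0) (g x))) => [h|h]; [left|].
  apply: eq_Sm => z; case: (boolP (lt z (g x0))) => [h2|h2] /=; last by rewrite add0r.
  by rewrite (cut_lt_trans c_co h2 h) addr0.
case: (eqVneq x x0) => [->|xx0]; [left|right].
  by apply: eq_Sm => z /=; rewrite addr0.
rewrite -l_1 -nsumD //.
have h' : lt (g x) (g x0).
  have : g x != g x0 by rewrite (inj_eq ginj).
  by move/(cut_lt_total x0 c_co); rewrite (negbTE h) orbF.
apply: eq_Sm => z /=; case: (boolP (lt z (g x0))) => [h2|h2] /=.
  by rewrite addrC.
case: (boolP (lt z (g x))) => h3; last by rewrite addrC.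
by rewrite (cut_lt_trans c_co h3 h') in h2.
Qed.

Let ivder_end y : ivder (l y) (l (g y)) (l y) = 1.
Proof. by rewrite /ivder subrr min_r ?ltW // /mobden mulr0 addr0 expr1n invr1. Qed.

Let ivder_start y : ivder (l y) (l (g y)) 0 = 1.
Proof. by rewrite /ivder subr0 min_l ?ltW // /mobden mulr0 addr0 expr1n invr1. Qed.

(** Expansion with slope 1 at the points outside the open intervals. *)
Lemma cmap_taylor_out t s : 0 <= t -> t <= 1 -> 0 <= s -> s <= 1 ->
  (forall y, t <= pos y \/ pos y + l y <= t) -> taylor sigma cmap K t 1 s.
Proof.
move=> t0 t1 s0 s1 tout.
have e0 : 0 <= K * sigma `|s - t| by rewrite mulr_ge0 // gauge_ge0.
have key y : `|piece s y - piece t y - (cl s y - cl t y)|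
    <= K * sigma `|s - t| * `|cl s y - cl t y|.
  have lip : `|cl s y - cl t y| <= `|s - t|.
    case: (leP s t) => [st|/ltW st].
      have /andP[? ?] := cl_lip c x0 l_gt0 y st.
      by rewrite !ler0_norm; lra.
    have /andP[? ?] := cl_lip c x0 l_gt0 y st.
    by rewrite !ger0_norm; lra.
  have dt : ivder (l y) (l (g y)) (cl t y) = 1.
    case: (tout y) => h; first by rewrite cl_left.
    by rewrite cl_right.
  have := ivmap_gauge sigmaG (l_gt0 y) (l_gt0 (g y)) M1 (gM y) (Mg y) C0 (g_gauge y)
    (cl_ge0 c x0 l t y) (cl_le c x0 l_gt0 t y) (cl_ge0 c x0 l s y) (cl_le c x0 l_gt0 s y).
  rewrite dt mul1r => /le_trans; apply; apply: ler_wpM2r => //; apply: ler_wpM2l => //.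
  exact: gauge_le.
have cls : nsummable (cl s) by exact: cl_sum.
have clt : nsummable (cl t) by exact: cl_sum.
have Ss : nsum (cl s) = s by exact: cl_total.
have St : nsum (cl t) = t by exact: cl_total.
rewrite /taylor /cmap mul1r.
case: (leP s t) => [st|/ltW st].
  have h := @nsum_abs _ _ (piece t) (piece s) (cl t) (cl s) _ e0
    (piece_sum t) (piece_sum s) clt cls.
  have abs_ts : `|s - t| = t - s by rewrite ler0_norm ?opprB // subr_le0.
  rewrite Ss St in h; rewrite -normrN [X in _ <= _ * X]abs_ts.
  rewrite (_ : - (pos (g x0) + nsum (piece s) - (pos (g x0) + nsum (piece t)) - (s - t))
    = nsum (piece t) - nsum (piece s) - (t - s)); last by ring.
  apply: h => y; have /andP[clst _] := cl_lip c x0 l_gt0 y st.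
  have abs_cl : `|cl s y - cl t y| = cl t y - cl s y by rewrite distrC ger0_norm.
  have := key y; rewrite -normrN [X in _ <= _ * X]abs_cl.
  by rewrite (_ : - (piece s y - piece t y - (cl s y - cl t y))
    = piece t y - piece s y - (cl t y - cl s y)); last by ring.
have h := @nsum_abs _ _ (piece s) (piece t) (cl s) (cl t) _ e0
  (piece_sum s) (piece_sum t) cls clt.
rewrite Ss St in h; rewrite [X in _ <= _ * X]ger0_norm ?subr_ge0 //.
rewrite (_ : pos (g x0) + nsum (piece s) - _ - _ =
  nsum (piece s) - nsum (piece t) - (s - t)); last by ring.
apply: h => y; have /andP[clst _] := cl_lip c x0 l_gt0 y st.
by have := key y; rewrite [X in _ <= _ * X]ger0_norm.
Qed.

Lemma cmap_taylor_in x v w : 0 <= v -> v <= l x -> 0 <= w -> w <= l x ->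
  taylor sigma cmap K (pos x + v) (ivder (l x) (l (g x)) v) (pos x + w).
Proof.
move=> v0 vl w0 wl; rewrite /taylor !cmap_mid //.
have -> : pos x + w - (pos x + v) = w - v by ring.
rewrite (_ : cmap (pos x) + _ - _ = ivmap (l x) (l (g x)) w - ivmap (l x) (l (g x)) v).
  exact: ivmap_gauge.
by ring.
Qed.

(** Points that are not in any open interval of the family. *)
Let out t := forall y, t <= pos y \/ pos y + l y <= t.

Let out_left x : out (pos x).
Proof.
move=> y; case: (eqVneq y x) => [->|yx]; first by left.
by case/orP: (cut_lt_total x0 c_co yx) => /(pos_lt c_co l_gt0 l_sum) h;
  [right|left]; have := l_gt0 x; lra.
Qed.

Let out_right x : out (pos x + l x).
Proof.
move=> y; case: (eqVneq y x) => [->|yx]; first by right.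
by case/orP: (cut_lt_total x0 c_co yx) => /(pos_lt c_co l_gt0 l_sum) h;
  [right|left]; have := l_gt0 x; lra.
Qed.

(** The main estimate: a first order expansion at every point, with slope 1 at the
    endpoints of the fundamental domain. If [s] is outside the interval that
    contains [t], the two expansions meet at an endpoint of that interval. *)
Lemma cmap_taylor t : 0 <= t -> t <= 1 -> exists d, [/\ 0 < d,
  t = 0 \/ t = 1 -> d = 1 &
  forall s, 0 <= s -> s <= 1 -> taylor sigma cmap (3 * K) t d s].
Proof.
move=> t0 t1; have K3 : K <= 3 * K by rewrite ler_peMl ?ler1n.
case: (pselect (exists x, pos x < t /\ t < pos x + l x)) => [[x [xt tx]]|h]; last first.
  exists 1; split=> // s s0 s1; apply: (taylor_le sigmaG K3).
  apply: cmap_taylor_out => // y.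
  have [h1|h1] := leP t (pos y); first by left.
  have [h2|h2] := leP (pos y + l y) t; first by right.
  by exfalso; apply: h; exists y.
have px0 := pos_ge0 c x0 l_gt0 l_sum x.
have px1 := pos_le1 x0 c_co l_gt0 l_sum l_1 x.
have lx := l_gt0 x.
have v0 : 0 <= t - pos x by lra.
have v1 : t - pos x <= l x by lra.
have inside w : 0 <= w -> w <= l x ->
    taylor sigma cmap K t (ivder (l x) (l (g x)) (t - pos x)) (pos x + w).
  by move=> w0 w1; have := cmap_taylor_in v0 v1 w0 w1; rewrite addrC subrK.
exists (ivder (l x) (l (g x)) (t - pos x)); split.
- exact: ivder_gt0.
- by case=> ?; exfalso; lra.
move=> s s0 s1; have [h1|h1] := leP s (pos x).
  have pe : 0 <= pos x by []; have pe1 : pos x <= 1 by lra.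
  apply: (@taylor_chain _ _ sigmaG _ _ _ _ (pos x)) => //; last by lra.
  - by apply/orP; right; apply/andP; split; lra.
  - by have := inside 0; rewrite addr0; apply; lra.
  - exact: (cmap_taylor_out pe pe1 t0 t1 (@out_left x)).
  - exact: (cmap_taylor_out pe pe1 s0 s1 (@out_left x)).
have [h2|h2] := leP (pos x + l x) s.
  have pe : 0 <= pos x + l x by lra.
  apply: (@taylor_chain _ _ sigmaG _ _ _ _ (pos x + l x)) => //; last by lra.
  - by apply/orP; left; apply/andP; split; lra.
  - by apply: inside; lra.
  - exact: (cmap_taylor_out pe px1 t0 t1 (@out_right x)).
  - exact: (cmap_taylor_out pe px1 s0 s1 (@out_right x)).
apply: (taylor_le sigmaG K3); rewrite (_ : s = pos x + (s - pos x)); last by ring.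
by apply: inside; lra.
Qed.

End CircleMap.

(** Periodic extension of a map of [[0, 1]] to a lift of a circle map. *)
Definition lift_of (R : realType) (f : R -> R) (t : R) : R :=
  (Num.floor t)%:~R + f (t - (Num.floor t)%:~R).

Section Lift.
Variables (R : realType) (sigma : R -> R) (f : R -> R) (K : R).
Hypotheses (sigmaG : gauge sigma) (K0 : 0 <= K) (f1 : f 1 = f 0 + 1).
Hypothesis f_taylor : forall t, 0 <= t -> t <= 1 -> exists d, [/\ 0 < d,
  t = 0 \/ t = 1 -> d = 1 &
  forall s, 0 <= s -> s <= 1 -> taylor sigma f K t d s].

Lemma lift_ofD (t : R) (n : int) : lift_of f (t + n%:~R) = lift_of f t + n%:~R.
Proof.
rewrite /lift_of floorDrz ?intr_int // intrKfloor intrD.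
by rewrite (_ : t + n%:~R - _ = t - (Num.floor t)%:~R); ring.
Qed.

Lemma lift_of_itv t : 0 <= t -> t <= 1 -> lift_of f t = f t.
Proof.
move=> t0; rewrite le_eqVlt => /orP[/eqP ->|t1].
  by rewrite /lift_of floor1 subrr f1 addrC.
have fl : Num.floor t = 0 by apply: floor_def; rewrite add0r t0 t1.
by rewrite /lift_of fl subr0 add0r.
Qed.

Let shift K' t d s (n : int) : taylor sigma (lift_of f) K' t d s ->
  taylor sigma (lift_of f) K' (t + n%:~R) d (s + n%:~R).
Proof.
rewrite /taylor !lift_ofD (_ : s + n%:~R - (t + n%:~R) = s - t); last by ring.
by rewrite (_ : lift_of f s + n%:~R - (lift_of f t + n%:~R) =
  lift_of f s - lift_of f t); last by ring.
Qed.

Let f_taylor1 t s : t = 0 \/ t = 1 -> 0 <= s -> s <= 1 -> taylor sigma f K t 1 s.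
Proof.
move=> ht s0 s1; have [||d [_ d1 h]] := @f_taylor t; try by case: ht => ->; lra.
by rewrite -(d1 ht); apply: h.
Qed.

Let itv t d s : 0 <= t -> t <= 1 -> 0 <= s -> s <= 1 ->
  taylor sigma f K t d s -> taylor sigma (lift_of f) K t d s.
Proof. by move=> *; rewrite /taylor !lift_of_itv. Qed.

Lemma lift_taylor t : exists2 d, 0 < d & forall s, `|s - t| < 1 ->
  taylor sigma (lift_of f) (3 * K) t d s.
Proof.
have K3 : K <= 3 * K by rewrite ler_peMl ?ler1n.
suff h u : 0 <= u -> u <= 1 -> exists2 d, 0 < d & forall s, `|s - u| < 1 ->
    taylor sigma (lift_of f) (3 * K) u d s.
  have /andP[n1 n2] := floor_itv t; rewrite intrD in n2.
  have [||d d0 hd] := h (t - (Num.floor t)%:~R); try by lra.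
  exists d => // s st; have := @shift _ _ _ _ (Num.floor t) (hd (s - (Num.floor t)%:~R) _).
  by rewrite !subrK; apply; rewrite (_ : s - _ - _ = s - t) //; ring.
move=> u0 u1; have [d [d0 d1 hd]] := f_taylor u0 u1; exists d => // s.
rewrite ltr_norml => /andP[s1 s2].
have end1 : taylor sigma (lift_of f) K 1 1 u.
  by apply: itv => //; apply: f_taylor1 => //; right.
have end0 : taylor sigma (lift_of f) K 0 1 u.
  by apply: itv => //; apply: f_taylor1 => //; left.
have [h1|h1] := leP 0 s; last first.
  apply: (@taylor_chain _ _ sigmaG _ _ _ _ 0) => //.
  - by apply/orP; right; rewrite u0 ltW.
  - by apply: itv => //; apply: hd.
  - have := @shift K 1 1 (s + 1) (-1).
    rewrite (_ : 1 + (-1)%:~R = 0); last by ring.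
    rewrite (_ : s + 1 + (-1)%:~R = s); last by ring.
    by apply; apply: itv; [..|apply: f_taylor1; [right|..]] => //; lra.
  - by move=> e; apply: d1; left.
have [h2|h2] := leP s 1; first by apply: (taylor_le sigmaG K3); apply: itv => //; exact: hd.
apply: (@taylor_chain _ _ sigmaG _ _ _ _ 1) => //.
- by apply/orP; left; rewrite u1 ltW.
- by apply: itv => //; apply: hd.
- have := @shift K 0 1 (s - 1) 1.
  rewrite add0r subrK; apply.
  by apply: itv; [..|apply: f_taylor1; [left|..]] => //; lra.
- by move=> e; apply: d1; right.
Qed.

End Lift.

(** * Circle maps given by lifts *)

Section Circle.
Variable R : realType.
Implicit Types (s t u : R) (p q : circle R).

Lemma to_circle_eq s t : to_circle s = to_circle t <-> exists n : int, s = t + n%:~R.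
Proof.
have -> : (to_circle s = to_circle t) <-> (s - t \is a Num.int).
  have := Quotient.idealrBE (int_subgroup R) s t.
  rewrite -topredE /= => ->; split; first by move=> h; apply/eqP; exact: h.
  by move/eqP.
split=> [/intrP[n e]|[n ->]]; first by exists n; rewrite -e addrC subrK.
by rewrite addrC addKr intr_int.
Qed.

Lemma to_circle_surj p : to_circle (repr p) = p.
Proof. exact: reprK. Qed.

Lemma repr_to_circle t : exists n : int, repr (to_circle t) = t + n%:~R.
Proof. by apply/to_circle_eq; rewrite to_circle_surj. Qed.

Lemma to_circleD t (n : int) : to_circle (t + n%:~R) = to_circle t.
Proof. by apply/to_circle_eq; exists n. Qed.

(** Every point of the circle has a representative in [[0, 1[]]. *)
Lemma to_circle_itv p : exists t, [/\ 0 <= t, t < 1 & to_circle t = p].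
Proof.
have /andP[h1 h2] := floor_itv (repr p); rewrite intrD in h2.
exists (repr p - (Num.floor (repr p))%:~R); split; [lra|lra|].
by rewrite -[RHS]to_circle_surj; apply/to_circle_eq; exists (- Num.floor (repr p));
  rewrite mulrNz.
Qed.

Lemma to_circle_inj s t : `|s - t| < 1 -> to_circle s = to_circle t -> s = t.
Proof.
move=> st /to_circle_eq[n e]; move: st.
rewrite e addrC addKr -intr_norm -[1]/(1%:~R) ltr_int => h.
have -> : n = 0 by lia.
by rewrite addr0.
Qed.

(** On a fundamental domain, the positive orientation is the usual order up to a
    cyclic permutation. *)
Lemma positively_orderedE s t u : `|s - t| < 1 -> `|t - u| < 1 -> `|s - u| < 1 ->
  positively_ordered (to_circle s) (to_circle t) (to_circle u) <->
  [\/ s < t /\ t < u, t < u /\ u < s | u < s /\ s < t].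
Proof.
rewrite !ltr_norml => /andP[st1 st2] /andP[tu1 tu2] /andP[su1 su2]; split.
  move=> [s' [t' [u' [/to_circle_eq[a ->] /to_circle_eq[b ->] /to_circle_eq[d ->]]]]].
  move=> /andP[h1 h2] h3.
  have {}h1 : s - t < (b - a)%:~R by rewrite intrB; clear -h1; lra.
  have {}h2 : t - u < (d - b)%:~R by rewrite intrB; clear -h2; lra.
  have {}h3 : (d - a)%:~R < s + 1 - u by rewrite intrB; clear -h3; lra.
  have k1m : (-1 < b - a)%R.
    by rewrite -(ltr_int R); apply: lt_trans h1; rewrite mulrNz.
  have k2m : (-1 < d - b)%R.
    by rewrite -(ltr_int R); apply: lt_trans h2; rewrite mulrNz.
  have k3m : (d - a < 1 + 1)%R.
    by rewrite -(ltr_int R); apply: lt_trans h3 _; clear -su2; rewrite intrD; lra.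
  (* only three of the integer offsets are compatible with the bounds *)
  have : (b - a = 0 /\ d - b = 0) \/ (b - a = 1 /\ d - b = 0) \/ (b - a = 0 /\ d - b = 1).
    by clear -k1m k2m k3m; lia.
  have dab : d - a = (d - b) + (b - a) by ring.
  rewrite dab in h3.
  case=> [|[]] [e1 e2]; rewrite e1 e2 ?addr0 ?add0r in h1 h2 h3;
    clear -h1 h2 h3; rewrite -?[0%:~R]/(0 : R) -?[1%:~R]/(1 : R) in h1 h2 h3.
  - by constructor 1; split; lra.
  - by constructor 2; split; lra.
  - by constructor 3; split; lra.
case=> -[h1 h2].
- by exists s, t, u; split=> //; [apply/andP|lra].
- exists (s - 1), t, u; split=> //; [|by apply/andP; split; lra|lra].
  by apply/to_circle_eq; exists (-1); rewrite mulrNz.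
- exists s, t, (u + 1); split=> //; [|by apply/andP; split; lra|lra].
  by apply/to_circle_eq; exists 1.
Qed.

(** A map to a fundamental domain that is increasing for the linear order obtained
    by cutting a circular order is cyclic-order-preserving. *)
Lemma cut_order_preserving (X : choiceType) (c : X -> X -> X -> int) (x0 : X)
    (e : X -> R) : circular_order c ->
  (forall x y, cut_lt c x0 x y -> e x < e y) -> (forall x y, `|e x - e y| < 1) ->
  cyclic_order_preserving c (@circle_order R) (fun x => to_circle (e x)).
Proof.
move=> c_co inc e1.
have incE x y : cut_lt c x0 x y <-> e x < e y.
  split; first exact: inc.
  case: (eqVneq x y) => [->|xy]; first by rewrite ltxx.
  case/orP: (cut_lt_total x0 c_co xy) => // /inc yx xy'.
  by have := lt_trans yx xy'; rewrite ltxx.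
have posE x y z : positively_ordered (to_circle (e x)) (to_circle (e y)) (to_circle (e z))
    <-> c x y z = 1.
  rewrite positively_orderedE // (circular_cut x0 c_co).
  by split; case=> -[/incE a /incE b]; [constructor 1|constructor 2|constructor 3
    |constructor 1|constructor 2|constructor 3].
move=> x y z; rewrite /circle_order.
case: asboolP => [/posE ->//|h1]; case: asboolP => [/posE|h2].
  by rewrite (circular_anti x0 c_co x y z) => h; lia.
have n1 : c x y z <> 1 by move/posE.
have n2 : c x y z <> -1.
  by move=> h; apply: h2; apply/posE; rewrite (circular_anti x0 c_co x y z) h.
by case: c_co => /(_ x y z); rewrite !inE => /or3P[]/eqP.
Qed.

Section LiftedMap.
Variables (sigma : R -> R) (K : R) (f h : R -> R).
Hypotheses (sigmaG : gauge sigma) (K0 : 0 <= K).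
Hypothesis fD : forall t (n : int), f (t + n%:~R) = f t + n%:~R.
Hypothesis h_gt0 : forall t, 0 < h t.
Hypothesis f_taylor : forall t s, `|s - t| < 1 -> taylor sigma f K t (h t) s.

(** The circle map with lift [f]. *)
Definition circle_map p : circle R := to_circle (f (repr p)).

Lemma circle_mapE t : circle_map (to_circle t) = to_circle (f t).
Proof.
have [n e] := repr_to_circle t.
by rewrite /circle_map e fD to_circleD.
Qed.

Lemma slope_lip s t : `|s - t| < 1 -> `|h t - h s| <= 2 * K * sigma `|s - t|.
Proof.
move=> st; case: (eqVneq s t) => [->|ne].
  by rewrite !subrr normr0 (gauge0 sigmaG) mulr0.
apply: taylor_swap ne (f_taylor st) (f_taylor _).
by rewrite distrC.
Qed.

Lemma gauge_cvg0 (e : R) : 0 < e ->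
  exists2 d, 0 < d < 1 & forall s, `|s| < d -> 2 * K * sigma `|s| <= e.
Proof.
move=> e0; have K1 : 0 < 2 * K + 1 by have := K0; lra.
have [d d0 hd] := gauge_small sigmaG (divr_gt0 e0 K1).
exists (Num.min d (2^-1)).
  by rewrite lt_min d0 invr_gt0 ltr0n /= gt_min; apply/orP; right; lra.
move=> s; rewrite lt_min => /andP[/ltW sd _].
have h1 := le_trans (gauge_le sigmaG (normr_ge0 s) sd) hd.
have h2 := gauge_ge0 sigmaG (normr_ge0 s).
rewrite ler_pdivlMr // in h1; lra.
Qed.

Lemma slope_periodic t (n : int) : h (t + n%:~R) = h t.
Proof.
apply/eqP; rewrite -subr_eq0 -normr_le0 leNgt; apply/negP => e0.
have e2 : 0 < `|h (t + n%:~R) - h t| / 2 by rewrite divr_gt0.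
have [d /andP[d0 d1] hd] := gauge_cvg0 e2.
have d2 : `|d / 2| = d / 2 by rewrite ger0_norm //; lra.
have dd : d / 2 < d by lra.
have dd1 : d / 2 < 1 by lra.
have := hd (d / 2); rewrite d2 => /(_ dd) hs.
have h1 := @f_taylor t (t + d / 2); have h2 := @f_taylor (t + n%:~R) (t + n%:~R + d / 2).
have eD : t + n%:~R + d / 2 = t + d / 2 + n%:~R by ring.
move: h1 h2; rewrite /taylor eD !fD.
have -> : t + d / 2 - t = d / 2 by ring.
have -> : t + d / 2 + n%:~R - (t + n%:~R) = d / 2 by ring.
have -> : f (t + d / 2) + n%:~R - (f t + n%:~R) = f (t + d / 2) - f t by ring.
rewrite d2 => /(_ dd1) h1 /(_ dd1) h2.
have : `|h (t + n%:~R) - h t| * (d / 2) <= 2 * K * sigma (d / 2) * (d / 2).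
  rewrite -[X in _ * X <= _]d2 -normrM.
  have -> : (h (t + n%:~R) - h t) * (d / 2) =
    (f (t + d / 2) - f t - h t * (d / 2)) -
    (f (t + d / 2) - f t - h (t + n%:~R) * (d / 2)) by ring.
  by apply: le_trans (ler_normB _ _) _; lra.
rewrite ler_pM2r; last by lra.
lra.
Qed.

(** The derivative of [circle_map] as a function on the circle. *)
Definition circle_slope p : R := h (repr p).

Lemma circle_slopeE t : circle_slope (to_circle t) = h t.
Proof.
by have [n e] := repr_to_circle t; rewrite /circle_slope e slope_periodic.
Qed.

Lemma lift_is_derive t : is_derive t 1 f (h t).
Proof.
have cv : (fun u => u^-1 *: ((f \o shift t) (u *: 1) - f t)) @ 0^' --> h t.
  apply/cvgrPdist_le => e e0.
  have [d /andP[d0 d1] hd] := gauge_cvg0 e0.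
  have := @dnbhs0_lt R R d d0; apply: filterS2 (nbhs_dnbhs_neq 0) => u u0 ud /=.
  have un : 0 < `|u| by rewrite normr_gt0.
  have e1 : t + u - t = u by ring.
  have := @f_taylor t (t + u); rewrite /taylor e1 => /(_ (lt_trans ud d1)) tu.
  have -> : u%:A + t = t + u by rewrite [u%:A]mulr1 addrC.
  have -> : h t - u^-1 *: (f (t + u) - f t) = - (f (t + u) - f t - h t * u) / u.
    rewrite [_ *: _]mulrC mulNr !mulrBl mulfK //; ring.
  rewrite normrM normrN normfV ler_pdivrMr // (le_trans tu) // ler_wpM2r //.
  have h1 := hd u ud; have h2 := gauge_ge0 sigmaG (normr_ge0 u).
  by apply: le_trans h1; rewrite ler_wpM2r // ler_peMl ?ler1n.
by apply: DeriveDef; [apply/cvg_ex; exists (h t)|exact: cvg_lim cv].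
Qed.

Lemma circle_map_derivative : is_circle_derivative circle_map circle_slope.
Proof.
exists f; split=> [t|t]; first exact: circle_mapE.
by rewrite circle_slopeE; exact: lift_is_derive.
Qed.

Lemma circle_map_C1 : circle_C1 circle_map.
Proof.
exists circle_slope; first exact: circle_map_derivative.
apply/quotient_continuous => t.
apply/cvgrPdist_le => e e0; have [d /andP[d0 d1] hd] := gauge_cvg0 e0.
near=> s; rewrite /= -!/(to_circle _) !circle_slopeE.
have st : `|s - t| < d.
  by rewrite distrC; near: s; exact: cvgr_dist_lt.
by apply: le_trans (slope_lip _) (hd _ st); exact: lt_trans d1.
Unshelve. all: by end_near. Qed.

Lemma circle_slope_gt0 p : 0 < circle_slope p.
Proof. exact: h_gt0. Qed.

Let dists p q := [set d | exists s t : R,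
    [/\ to_circle s = p, to_circle t = q & d = `|s - t|]].

Lemma circle_dist_ge0 p q : 0 <= circle_dist p q.
Proof.
apply: lb_le_inf; last by move=> _ [s [t [_ _ ->]]].
by exists `|repr p - repr q|, (repr p), (repr q); rewrite !to_circle_surj.
Qed.

Lemma circle_dist_lt p q d : circle_dist p q < d ->
  exists s t, [/\ to_circle s = p, to_circle t = q & `|s - t| < d].
Proof.
move=> hd; have [|_ [s [t [e1 e2 ->]]] h1] := @inf_lt _ (dists p q) _ _ hd.
  by exists `|repr p - repr q|, (repr p), (repr q); rewrite !to_circle_surj.
by exists s, t.
Qed.

Lemma circle_dist_lt1 p q : circle_dist p q < 1.
Proof.
have [s [s0 s1 <-]] := to_circle_itv p; have [t [t0 t1 <-]] := to_circle_itv q.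
apply: (@le_lt_trans _ _ `|s - t|); last by rewrite ltr_norml; apply/andP; split; lra.
apply: ge_inf; last by exists s, t.
by exists 0 => _ [? [? [_ _ ->]]].
Qed.

Lemma circle_slope_class : class_C sigma circle_slope.
Proof.
exists (4 * K) => _ [p [q [_ ->]]].
have K4 : 0 <= 4 * K by rewrite mulr_ge0.
have [->|d_neq0] := eqVneq (circle_dist p q) 0.
  (* division by 0 is 0 *)
  by rewrite (gauge0 sigmaG) invr0 mulr0.
have d0 : 0 < circle_dist p q by rewrite lt_neqAle eq_sym d_neq0 circle_dist_ge0.
have d1 := circle_dist_lt1 p q.
set d := circle_dist p q in d0 d1 *.
have [|s [t [<- <-]]] := @circle_dist_lt p q (Num.min 1 (2 * d)).
  by rewrite lt_min d1 -/d; lra.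
rewrite lt_min => /andP[st1 /ltW st2]; rewrite !circle_slopeE.
rewrite ler_pdivrMr ?(gauge_gt0 sigmaG) // distrC.
apply: le_trans (slope_lip _) _; first by [].
have K2 : 0 <= 2 * K by rewrite mulr_ge0.
have h1 : 2 * K * sigma `|s - t| <= 2 * K * (2 * sigma d).
  apply: ler_wpM2l => //; apply: le_trans (gauge_scale sigmaG _ (ltW d0)).
    exact: gauge_le.
  by rewrite ler1n.
by apply: (le_trans h1); rewrite (_ : 2 * K * _ = 4 * K * sigma d) //; ring.
Qed.

End LiftedMap.
End Circle.

(** * The action *)

Section Realization.
Variables (R : realType) (G : groupType) (X : choiceType) (act : G -> X -> X).
Variables (c : X -> X -> X -> int) (x0 : X) (l : X -> R) (sigma : R -> R).
Hypotheses (actG : is_left_action act) (c_co : circular_order c).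
Hypothesis c_act : forall g, cyclic_order_preserving c c (act g).
Hypotheses (l_gt0 : forall x, 0 < l x) (l_sum : nsummable l) (l_1 : nsum l = 1).
Hypothesis sigmaG : gauge sigma.
Hypothesis l_gauge : forall g, exists2 C, 0 <= C &
  forall x, `|l (act g x) / l x - 1| <= C * sigma (l x).

Local Notation pos := (pos c x0 l).

Let actK g : cancel (act g) (act g^-1%g).
Proof. by have [act1 actM] := actG => x; rewrite -actM mulVg act1. Qed.

Let actVK g : cancel (act g^-1%g) (act g).
Proof. by have [act1 actM] := actG => x; rewrite -actM mulgV act1. Qed.

Let length_ratio g : exists2 M, 1 <= M & forall x, l (act g x) <= M * l x.
Proof.
have [C C0 hC] := l_gauge g.
have s1 : 0 <= sigma 1 by exact: gauge_ge0.
exists (1 + C * sigma 1); first by rewrite lerDl mulr_ge0.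
move=> x; have lx := l_gt0 x; rewrite -ler_pdivrMr //.
have h1 := le_trans (ler_norm _) (hC x).
have h2 : C * sigma (l x) <= C * sigma 1.
  apply: ler_wpM2l => //; apply: gauge_le => //; first exact: ltW.
  exact: (l_le1 x0 c_co l_gt0 l_sum l_1 x).
lra.
Qed.

(** The lift to the line of the circle map attached to [g]. *)
Definition glift (g : G) : R -> R := lift_of (cmap c x0 l (act g)).

Let cmap01 g : cmap c x0 l (act g) 1 = cmap c x0 l (act g) 0 + 1.
Proof.
by rewrite (cmap1 x0 c_co l_gt0 l_sum l_1 (actK g) (actVK g)) (cmap0 c x0 _ l_gt0 l_sum).
Qed.

Lemma glift_taylor g : exists K h, [/\ 0 <= K, forall t, 0 < h t &
  forall t s, `|s - t| < 1 -> taylor sigma (glift g) K t (h t) s].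
Proof.
have [C C0 hC] := l_gauge g.
have [M1 M11 hM1] := length_ratio g.
have [M2 M21 hM2] := length_ratio g^-1%g.
pose M := Num.max M1 M2.
have M_ge1 : 1 <= M by rewrite le_max M11.
have gM x : l (act g x) <= M * l x.
  by apply: le_trans (hM1 x) _; rewrite ler_pM2r // le_max lexx.
have Mg x : l x <= M * l (act g x).
  have := hM2 (act g x); rewrite actK => /le_trans; apply.
  by rewrite ler_pM2r // le_max lexx orbT.
have T := cmap_taylor x0 c_co l_gt0 l_sum l_1 sigmaG (actK g) (actVK g) M_ge1 C0 gM Mg hC.
set K := 3 * _ in T.
have K0 : 0 <= K.
  by apply: mulr_ge0 => //; apply: mulr_ge0 => //; apply: mulr_ge0 => //;
    apply: exprn_ge0; apply: le_trans M_ge1.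
have L t := lift_taylor sigmaG K0 (cmap01 g) T t.
have /choice[h hP] t : exists d, 0 < d /\ forall s, `|s - t| < 1 ->
    taylor sigma (glift g) (3 * K) t d s.
  by have [d d0 hd] := L t; exists d.
exists (3 * K), h; split=> [|t|t]; [by rewrite mulr_ge0| |]; by case: (hP t).
Qed.

Lemma gliftD g t (n : int) : glift g (t + n%:~R) = glift g t + n%:~R.
Proof. exact: lift_ofD. Qed.

(** The lift acts on the translates of the intervals through [ivmap], up to
    integers. *)
Lemma glift_arc g x v (n : int) : 0 <= v -> v <= l x -> exists m : int,
  glift g (pos x + v + n%:~R) = pos (act g x) + ivmap (l x) (l (act g x)) v + m%:~R.
Proof.
move=> v0 v1; rewrite gliftD.
have p0 := pos_ge0 c x0 l_gt0 l_sum x.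
have p1 := pos_le1 x0 c_co l_gt0 l_sum l_1 x.
rewrite /glift lift_of_itv ?cmap01 //; try lra.
rewrite (cmap_mid x0 c_co l_gt0 l_sum (actK g) (actVK g)) //.
have [->|->] := cmap_pos x0 c_co l_gt0 l_sum l_1 (actK g) (actVK g) (c_act g) x.
  by exists n.
by exists (n + 1); rewrite intrD; ring.
Qed.

Lemma glift_continuous g : continuous (glift g).
Proof.
have [K [h [K0 h0 hT]]] := glift_taylor g.
move=> t; apply: differentiable_continuous; apply/derivable1_diffP.
by have [] := lift_is_derive sigmaG K0 hT t.
Qed.

Lemma arcs_dense u v : u < v -> exists x w (n : int),
  [/\ 0 < w, w < l x, u < pos x + w + n%:~R & pos x + w + n%:~R < v].
Proof.
move=> uv; have /andP[h1 h2] := floor_itv u; rewrite intrD in h2.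
set n := Num.floor u in h1 h2.
have [|||x [t [t1 t2 t3 t4]]] := pos_dense x0 c_co l_gt0 l_sum l_1
    (u := u - n%:~R) (v := Num.min (v - n%:~R) 1).
- lra.
- by rewrite lt_min; apply/andP; split; lra.
- by rewrite ge_min lexx orbT.
exists x, (t - pos x), n; move: t4; rewrite lt_min => /andP[t4 _].
by split; lra.
Qed.

(** A continuous function with integer values on the translates of the intervals
    has integer values. *)
Lemma int_valued (D : R -> R) : continuous D ->
  (forall x w (n : int), 0 <= w -> w <= l x ->
     exists m : int, D (pos x + w + n%:~R) = m%:~R) ->
  forall t, exists m : int, D t = m%:~R.
Proof.
move=> Dc hD t; have /andP[h1 h2] := floor_itv (D t); rewrite intrD in h2.
set n := Num.floor (D t) in h1 h2.
have [<-|ne] := eqVneq n%:~R (D t); first by exists n.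
have h1' : n%:~R < D t by rewrite lt_neqAle ne.
pose e := Num.min (D t - n%:~R) (n%:~R + 1 - D t).
have e0 : 0 < e by rewrite lt_min; apply/andP; split; lra.
have /nbhs_ballP[d /= d0 hd] : \forall s \near t, `|D t - D s| < e.
  by have /cvgrPdist_lt/(_ _ e0) := Dc t.
have [|x [w [m [w0 w1 u1 u2]]]] := @arcs_dense (t - d) (t + d).
  lra.
have [k hk] := hD x w m (ltW w0) (ltW w1).
have : `|D t - D (pos x + w + m%:~R)| < e.
  by apply: hd; rewrite /ball /= ltr_norml; apply/andP; split; lra.
rewrite hk lt_min !ltr_norml => /andP[/andP[a1 a2] /andP[a3 a4]].
have nk : (n < k)%R by rewrite -(ltr_int R); lra.
have kn : (k < n + 1)%R by rewrite -(ltr_int R) intrD; lra.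
by move: kn; rewrite ltzD1 leNgt nk.
Qed.

(** The action on the circle. *)
Definition rho (g : G) : circle R -> circle R := circle_map (glift g).

Lemma rhoE g t : rho g (to_circle t) = to_circle (glift g t).
Proof. exact: circle_mapE (gliftD g) t. Qed.

Lemma rho_arc g x w : 0 <= w -> w <= l x ->
  rho g (to_circle (pos x + w)) =
  to_circle (pos (act g x) + ivmap (l x) (l (act g x)) w).
Proof.
move=> w0 w1; rewrite rhoE.
by have [m] := glift_arc g 0 w0 w1; rewrite addr0 => ->; rewrite to_circleD.
Qed.

Lemma rho_action : is_left_action rho.
Proof.
have [act1 actM] := actG; split=> [p|g h p].
  rewrite -(to_circle_surj p) rhoE; apply/to_circle_eq.
  have [||m hm] := @int_valued (fun t => glift 1%g t - t) _ _ (repr p).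
  - by move=> t; apply: continuousB => //; exact: glift_continuous.
  - move=> x w n w0 w1; have [m ->] := glift_arc 1%g n w0 w1.
    by exists (m - n); rewrite act1 ivmap_id intrB; ring.
  by exists m; rewrite -hm; ring.
rewrite -(to_circle_surj p) !rhoE; apply/to_circle_eq.
have [||m hm] := @int_valued (fun t => glift (g * h)%g t - glift g (glift h t)) _ _ (repr p).
- move=> t; apply: continuousB; first exact: glift_continuous.
  by apply: continuous_comp; exact: glift_continuous.
- move=> x w n w0 w1; have [m ->] := glift_arc (g * h)%g n w0 w1.
  have [m1 ->] := glift_arc h n w0 w1.
  have /andP[i0 i1] := ivmap_itv (l_gt0 x) (l_gt0 (act h x)) w0 w1.
  have [m2 ->] := glift_arc g m1 i0 i1.
  by exists (m - m2); rewrite actM ivmap_comp // intrB; ring.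
by exists m; rewrite -hm; ring.
Qed.

Lemma rho_diff g : Diff1_plus sigma (rho g).
Proof.
have [rho1 rhoM] := rho_action.
have C1 h : circle_C1 (rho h).
  have [K [s [K0 s0 hT]]] := glift_taylor h.
  exact: circle_map_C1 sigmaG K0 (gliftD h) hT.
split.
  exists (rho g^-1%g); split=> //.
  - by move=> p; rewrite -rhoM mulVg rho1.
  - by move=> p; rewrite -rhoM mulgV rho1.
have [K [s [K0 s0 hT]]] := glift_taylor g.
exists (circle_slope s); split.
- exact: circle_map_derivative sigmaG K0 (gliftD g) hT.
- exact: circle_slope_gt0.
- exact: circle_slope_class sigmaG K0 (gliftD g) hT.
Qed.

Let arc_proof x : 0 < pos x + l x - pos x <= 1.
Proof. by rewrite addrAC subrr add0r l_gt0 (l_le1 x0 c_co l_gt0 l_sum l_1). Qed.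

(** The interval of [x], as an arc of the circle. *)
Definition arc (x : X) : open_arc R := OpenArc (arc_proof x).

Let arcP x p : arc_set (arc x) p <->
  exists w, [/\ 0 < w, w < l x & p = to_circle (pos x + w)].
Proof.
split=> [[t /=]|[w [w0 w1 ->]]].
  rewrite in_itv /= => /andP[t0 t1] <-.
  by exists (t - pos x); split; [lra|lra|rewrite addrC subrK].
by exists (pos x + w) => //=; rewrite in_itv /=; apply/andP; split; lra.
Qed.

Lemma arc_disjoint x y : x <> y -> arc_set (arc x) `&` arc_set (arc y) = set0.
Proof.
move=> /eqP xy; apply/seteqP; split=> // p [/arcP[v [v0 v1 ->]] /arcP[w [w0 w1]]] e.
have px0 := pos_ge0 c x0 l_gt0 l_sum x; have py0 := pos_ge0 c x0 l_gt0 l_sum y.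
have px1 := pos_le1 x0 c_co l_gt0 l_sum l_1 x.
have py1 := pos_le1 x0 c_co l_gt0 l_sum l_1 y.
have /(_ _)/wrap[] := to_circle_inj _ e.
  by rewrite ltr_norml; apply/andP; split; lra.
case/orP: (cut_lt_total x0 c_co xy) => /(pos_lt c_co l_gt0 l_sum); lra.
Qed.

Lemma arc_dense : dense (\bigcup_(x in [set: X]) arc_set (arc x)).
Proof.
move=> O [p Op] openO.
have : open ((@to_circle R) @^-1` O) by exact: openO.
rewrite openE => /(_ (repr p)); rewrite /= to_circle_surj => /(_ Op).
move=> /nbhs_ballP[d /= d0 hd].
have [|x [w [m [w0 w1 u1 u2]]]] := @arcs_dense (repr p - d) (repr p + d).
  lra.
exists (to_circle (pos x + w)); split; last by exists x => //; apply/arcP; exists w.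
rewrite -(to_circleD _ m); apply: hd.
by rewrite /ball /= ltr_norml; apply/andP; split; lra.
Qed.

Lemma arc_left_order :
  cyclic_order_preserving c (@circle_order R) (fun x => left_endpoint (arc x)).
Proof.
apply: (cut_order_preserving (x0 := x0) (e := pos)) => // x y.
  by move=> /(pos_lt c_co l_gt0 l_sum) h; have := l_gt0 x; lra.
have px0 := pos_ge0 c x0 l_gt0 l_sum x; have py0 := pos_ge0 c x0 l_gt0 l_sum y.
have px1 := pos_le1 x0 c_co l_gt0 l_sum l_1 x.
have py1 := pos_le1 x0 c_co l_gt0 l_sum l_1 y.
have lx := l_gt0 x; have ly := l_gt0 y.
by rewrite ltr_norml /=; apply/andP; split; lra.
Qed.

Lemma arc_right_order :
  cyclic_order_preserving c (@circle_order R) (fun x => right_endpoint (arc x)).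
Proof.
apply: (cut_order_preserving (x0 := x0) (e := fun x => pos x + l x)) => // x y.
  by move=> /(pos_lt c_co l_gt0 l_sum) h; have ly := l_gt0 y; lra.
have px0 := pos_ge0 c x0 l_gt0 l_sum x; have py0 := pos_ge0 c x0 l_gt0 l_sum y.
have px1 := pos_le1 x0 c_co l_gt0 l_sum l_1 x.
have py1 := pos_le1 x0 c_co l_gt0 l_sum l_1 y.
have lx := l_gt0 x; have ly := l_gt0 y.
by rewrite ltr_norml /=; apply/andP; split; lra.
Qed.

Lemma rho_arc_set g x : rho g @` arc_set (arc x) = arc_set (arc (act g x)).
Proof.
apply/seteqP; split=> [_ [_ /arcP[w [w0 w1 ->]] <-]|p /arcP[w [w0 w1 ->]]].
  rewrite rho_arc ?ltW //; apply/arcP.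
  have /andP[i0 i1] := ivmap_itvoo (l_gt0 x) (l_gt0 (act g x)) w0 w1.
  by exists (ivmap (l x) (l (act g x)) w).
have /andP[i0 i1] := ivmap_itvoo (l_gt0 (act g x)) (l_gt0 x) w0 w1.
exists (to_circle (pos x + ivmap (l (act g x)) (l x) w)).
  by apply/arcP; exists (ivmap (l (act g x)) (l x) w).
by rewrite rho_arc ?ltW // ivmap_comp ?ivmap_id // ltW.
Qed.

Lemma rho_arc_id g x : act g x = x -> forall p, arc_set (arc x) p -> rho g p = p.
Proof.
by move=> gx p /arcP[w [w0 w1 ->]]; rewrite rho_arc ?ltW // gx ivmap_id.
Qed.

End Realization.

Theorem proposition4p1 (R : realType) (G : groupType) (X : choiceType)
  (act : G -> X -> X) (c : X -> X -> X -> int) (F : nat -> R) (sigma : R -> R)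
  (countable_G : countable [set: G])
  (nonempty_X : [set: X] !=set0)
  (countable_X : countable [set: X])
  (GX : cyclically_ordered_Gset act c)
  (subexp_X : subexponential_orbits R act)
  (F_ge1 : forall n, 1 <= F n)
  (F_nondecreasing : nondecreasing_seq F)
  (F_ratio : (fun n => F n.+1 / F n) @ \oo --> (1 : R))
  (F_summable : forall (S : set G) (x : X), finite_set S ->
    (\sum_(0 <= n <oo) ((card_power_orbit act S n x)%:R / F n)%:E < +oo)%E)
  (sigma_modulus : modulus_of_continuity sigma)
  (sigma_decreasing : forall s t : R, 0 < s -> s <= t ->
    sigma t / t <= sigma s / s)
  (F_sigma : (limn_esup (fun n =>
    (`|F n.+1 / F n - 1| * (1 / sigma ((F n)^-1)))%:E) < +oo)%E) :
  exists (rho : G -> circle R -> circle R) (J : X -> open_arc R),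
    (is_left_action rho /\ forall g, Diff1_plus sigma (rho g)) /\
    [/\ (forall x y, x <> y -> arc_set (J x) `&` arc_set (J y) = set0) /\
        dense (\bigcup_(x in [set: X]) arc_set (J x)),
        cyclic_order_preserving c (@circle_order R)
          (fun x => left_endpoint (J x)) /\
        cyclic_order_preserving c (@circle_order R)
          (fun x => right_endpoint (J x))
      & forall g x,
          rho g @` arc_set (J x) = arc_set (J (act g x)) /\
          (act g x = x -> forall p, arc_set (J x) p -> rho g p = p)].
Proof.
have [x0 _] := nonempty_X; have [c_co actG c_act] := GX.
have sigmaG := gauge_modulus sigma_modulus sigma_decreasing.
have [l [l_gt0 l_sum l_1 l_gauge]] := lengths_exist actG countable_G countable_X
  F_ge1 F_nondecreasing F_summable x0 sigmaG F_sigma.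
exists (rho act c x0 l), (arc x0 c_co l_gt0 l_sum l_1).
split; [split=> [|g]|split].
- exact: (rho_action x0 actG c_co c_act l_gt0 l_sum l_1 sigmaG l_gauge).
- exact: (rho_diff x0 actG c_co c_act l_gt0 l_sum l_1 sigmaG l_gauge).
- by split; [exact: arc_disjoint|exact: arc_dense].
- by split; [exact: arc_left_order|exact: arc_right_order].
- by move=> g x; split; [exact: (rho_arc_set x0 actG c_co c_act)|exact: rho_arc_id].
Qed.
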